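(* Let $R$ be a Noetherian local ring and $E\subseteq G\simeq R^e$ a finitely generated torsionfree $R$-module having rank $e>0$, but not free. Then $$\ell\Big(\bigwedge\nolimits^{e}E\Big)\ \ge\ \operatorname{ht}F_0(G/E).$$ If $E$ is an ideal module, then $$\ell\Big(\bigwedge\nolimits^{e}E\Big)\ \ge\ \operatorname{ht}F_e(E).$$
   Context: A finitely generated module $E$ over a Noetherian ring $R$ with total ring of fractions $Q$ has rank $e$ if $E\otimes_RQ\simeq Q^e$. $\tau_R(M)$ is the submodule of elements of $M$ killed by a non-zero-divisor of $R$. For a finitely generated module $M$ having a rank, over a Noetherian local ring $(R,\mathfrak m,k)$, the Rees algebra is $\mathcal R(M)=\mathcal S(M)/\tau_R(\mathcal S(M))$, where $\mathcal S(M)$ is the symmetric algebra, and the analytic spread $\ell(M)$ is the Krull dimension of the fiber cone $\mathcal R(M)\otimes_Rk$. $F_i(M)$ denotes the $i$-th Fitting ideal: if $R^m\xrightarrow{\varphi}R^n\to M\to 0$ is a finite presentation, $F_i(M)=I_{n-i}(\varphi)$ is the ideal generated by the $(n-i)\times(n-i)$ minors of $\varphi$. A torsionfree module $E\subseteq G\simeq R^e$ is an ideal module if $\operatorname{grade}G/E\ge 2$, where the grade of a finitely generated module is the grade of its annihilator. *)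

(* Defs.v *)
(* Rings are `comPzRingType` where a quotient by an arbitrary ideal must again be
   a ring; ideals and submodules are classical sets. *)
From HB Require Import structures.
From mathcomp Require Import all_boot all_order all_algebra generic_quotient.
From mathcomp Require Import boolp classical_sets functions constructive_ereal.
From mathcomp.multinomials Require Import -(notations) monalg.

Set Implicit Arguments.
Unset Strict Implicit.
Unset Printing Implicit Defensive.

Import Order.TTheory GRing.Theory Num.Theory.

Local Open Scope classical_set_scope.
Local Open Scope ring_scope.
Local Open Scope quotient_scope.

Section Submodules.
Variables (R : pzRingType) (V : lmodType R).

Definition submodule (W : set V) : Prop :=
  W 0 /\ forall (a : R) (x y : V), W x -> W y -> W (a *: x + y).

Definition lspan (X : set V) : set V := smallest submodule X.

Lemma submodule_lspan (X : set V) : submodule (lspan X).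
Proof.
split=> [W [[]]//|a x y Hx Hy W [HW XW]].
by apply: (proj2 HW); [apply: Hx|apply: Hy].
Qed.

Lemma lspan0 (X : set V) : lspan X 0.
Proof. exact: (proj1 (submodule_lspan X)). Qed.

Lemma lspanP (X : set V) a x y : lspan X x -> lspan X y -> lspan X (a *: x + y).
Proof. exact: (proj2 (submodule_lspan X)). Qed.

Lemma lspanD (X : set V) x y : lspan X x -> lspan X y -> lspan X (x + y).
Proof. by move=> Hx Hy; rewrite -[x]scale1r; apply: lspanP. Qed.

Lemma lspanZ (X : set V) a x : lspan X x -> lspan X (a *: x).
Proof. by move=> Hx; rewrite -[_ *: _]addr0; apply: lspanP => //; apply: lspan0. Qed.

Lemma lspanN (X : set V) x : lspan X x -> lspan X (- x).
Proof. by rewrite -scaleN1r; apply: lspanZ. Qed.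

Lemma sub_lspan (X : set V) : X `<=` lspan X.
Proof. exact: sub_gen_smallest. Qed.

Lemma lspan_sub (X W : set V) : submodule W -> X `<=` W -> lspan X `<=` W.
Proof. exact: smallest_sub. Qed.

End Submodules.

Section QuotientModule.
Variables (R : pzRingType) (V : lmodType R) (X : set V).

Definition qrel : rel V := fun x y => `[< lspan X (x - y) >].

Fact qrel_refl : reflexive qrel.
Proof. by move=> x; apply/asboolP; rewrite subrr; apply: lspan0. Qed.

Fact qrel_sym : symmetric qrel.
Proof.
by move=> x y; apply/asboolP/asboolP => /lspanN; rewrite opprB.
Qed.

Fact qrel_trans : transitive qrel.
Proof.
move=> y x z /asboolP xy /asboolP yz; apply/asboolP.
by have := lspanD xy yz; rewrite addrA subrK.
Qed.

Canonical qrel_equiv := EquivRel qrel qrel_refl qrel_sym qrel_trans.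

(* V / <X>, the quotient by the submodule generated by X. *)
Definition quotmod := {eq_quot qrel}.

HB.instance Definition _ : EqQuotient _ qrel quotmod := EqQuotient.on quotmod.
HB.instance Definition _ := Choice.on quotmod.

End QuotientModule.

(* The canonical map and the addition are sealed: otherwise failed matches of
   `_ + _` unfold them down to the underlying free modules. *)
HB.lock Definition qpi (R : pzRingType) (V : lmodType R) (X : set V) (x : V) :
  quotmod X := \pi x.

HB.lock Definition qadd (R : pzRingType) (V : lmodType R) (X : set V)
  (x y : quotmod X) : quotmod X := qpi X (repr x + repr y).

Section QuotientModuleTheory.
Variables (R : pzRingType) (V : lmodType R) (X : set V).
Local Notation quotmod := (@quotmod R V X).
Local Notation qpi := (@qpi R V X).
Local Notation qadd := (@qadd R V X).

Lemma qpi_repr (x : quotmod) : qpi (repr x) = x.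
Proof. by rewrite qpi.unlock reprK. Qed.

Lemma qpiP (x y : V) : qpi x = qpi y <-> lspan X (x - y).
Proof.
have E : (qpi x == qpi y) = qrel X x y by rewrite qpi.unlock eqmodE.
by split=> [xy|xy]; [apply/asboolP; rewrite -[asbool _]E xy|
  apply/eqP; rewrite E; apply/asboolP].
Qed.

Lemma qpi_ind (P : quotmod -> Prop) : (forall x, P (qpi x)) -> forall x, P x.
Proof. by move=> H x; rewrite -[x]qpi_repr. Qed.

Lemma qrepr (x : V) : lspan X (repr (qpi x) - x).
Proof. by apply/qpiP; rewrite qpi_repr. Qed.

Definition qopp (x : quotmod) : quotmod := qpi (- repr x).
Definition qscale (a : R) (x : quotmod) : quotmod := qpi (a *: repr x).

Lemma qaddE x y : qadd (qpi x) (qpi y) = qpi (x + y).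
Proof.
by rewrite qadd.unlock; apply/qpiP; rewrite opprD addrACA; apply: lspanD; apply: qrepr.
Qed.

Lemma qoppE x : qopp (qpi x) = qpi (- x).
Proof. by apply/qpiP; rewrite -opprD; apply: lspanN; apply: qrepr. Qed.

Lemma qscaleE a x : qscale a (qpi x) = qpi (a *: x).
Proof. by apply/qpiP; rewrite -scalerBr; apply: lspanZ; apply: qrepr. Qed.

Fact qaddA : associative qadd.
Proof.
by elim/qpi_ind=> x; elim/qpi_ind=> y; elim/qpi_ind=> z; rewrite !qaddE addrA.
Qed.

Fact qaddC : commutative qadd.
Proof. by elim/qpi_ind=> x; elim/qpi_ind=> y; rewrite !qaddE addrC. Qed.

Fact qadd0 : left_id (qpi 0) qadd.
Proof. by elim/qpi_ind=> x; rewrite qaddE add0r. Qed.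

Fact qaddN : left_inverse (qpi 0) qopp qadd.
Proof. by elim/qpi_ind=> x; rewrite qoppE qaddE addNr. Qed.

HB.instance Definition _ := GRing.isZmodule.Build quotmod qaddA qaddC qadd0 qaddN.

Fact qscaleA a b x : qscale a (qscale b x) = qscale (a * b) x.
Proof. by elim/qpi_ind: x => x; rewrite !qscaleE scalerA. Qed.

Fact qscale1 : left_id 1 qscale.
Proof. by elim/qpi_ind=> x; rewrite qscaleE scale1r. Qed.

Fact qscaleDr : right_distributive qscale +%R.
Proof.
move=> a; elim/qpi_ind=> x; elim/qpi_ind=> y.
by rewrite -[_ + _]/(qadd _ _) -[RHS]/(qadd _ _) !(qscaleE, qaddE) scalerDr.
Qed.

Fact qscaleDl x : {morph qscale^~ x : a b / a + b}.
Proof.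
move=> a b; elim/qpi_ind: x => x.
by rewrite -[RHS]/(qadd _ _) !(qscaleE, qaddE) scalerDl.
Qed.

HB.instance Definition _ :=
  GRing.Zmodule_isLmodule.Build R quotmod qscaleA qscale1 qscaleDr qscaleDl.

Fact qpi_linear : linear qpi.
Proof.
by move=> a x y; rewrite -[RHS]/(qadd (qscale _ _) _) qscaleE qaddE.
Qed.

HB.instance Definition _ := GRing.isLinear.Build R V quotmod _ qpi qpi_linear.

End QuotientModuleTheory.

HB.lock Definition quotlift (R : pzRingType) (V W : lmodType R) (X : set V)
  (f : V -> W) (x : quotmod X) : W := f (repr x).

Section QuotientLift.
Variables (R : pzRingType) (V W : lmodType R) (X : set V).
Variable f : {linear V -> W}.
Hypothesis fX : forall x, X x -> f x = 0.

Local Notation quotlift := (@quotlift R V W X f).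

Lemma quotlift_qpi x : quotlift (qpi X x) = f x.
Proof.
have kerf : submodule [set x | f x = 0].
  split=> [|a y z /= fy fz]; first exact: raddf0.
  by rewrite linearP fy fz scaler0 addr0.
have Xker : X `<=` [set x | f x = 0] by move=> y /fX.
have /= := lspan_sub kerf Xker (qrepr (X := X) x).
by rewrite quotlift.unlock raddfB => /subr0_eq.
Qed.

Lemma quotlift_linear : linear quotlift.
Proof.
move=> a; elim/qpi_ind=> x; elim/qpi_ind=> y.
by rewrite -linearP !quotlift_qpi linearP.
Qed.

End QuotientLift.

Section RestrictionOfScalars.
Variables R A : comPzRingType.

(* The R-algebra A with structure map f, seen as an R-module.  MathComp's
   algebra structures exclude the zero ring, hence the explicit structure map. *)
Definition resmod (f : {rmorphism R -> A}) : Type := A.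

Variable f : {rmorphism R -> A}.
Local Notation Af := (resmod f).

HB.instance Definition _ := GRing.ComPzRing.on Af.

Definition resscale (a : R) (x : Af) : Af := f a * x.

Fact resscaleA a b x : resscale a (resscale b x) = resscale (a * b) x.
Proof. by rewrite /resscale rmorphM mulrA. Qed.

Fact resscale1 : left_id 1 resscale.
Proof. by move=> x; rewrite /resscale rmorph1 mul1r. Qed.

Fact resscaleDr : right_distributive resscale +%R.
Proof. by move=> a x y; rewrite /resscale mulrDr. Qed.

Fact resscaleDl x : {morph resscale^~ x : a b / a + b}.
Proof. by move=> a b; rewrite /resscale rmorphD mulrDl. Qed.

HB.instance Definition _ := GRing.Zmodule_isLmodule.Build R Af
  resscaleA resscale1 resscaleDr resscaleDl.

Lemma resscaleE (a : R) (x : Af) : a *: x = (f a : Af) * x.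
Proof. by []. Qed.

Lemma resscaleAl (a : R) (x y : Af) : a *: (x * y) = a *: x * y.
Proof. exact: mulrA. Qed.

Lemma resscaleAr (a : R) (x y : Af) : a *: (x * y) = x * (a *: y).
Proof. exact: mulrCA. Qed.

End RestrictionOfScalars.

Section Ideals.
Variable A : comPzRingType.

Definition ideal (I : set A) : Prop := submodule (I : set A^o).

Definition ideal_gen (X : set A) : set A := lspan (X : set A^o).

Definition prime_ideal (P : set A) : Prop :=
  [/\ ideal P, ~ P 1 & forall x y, P (x * y) -> P x \/ P y].

Definition maximal_ideal (M : set A) : Prop :=
  [/\ ideal M, ~ M 1 &
      forall I : set A, ideal I -> M `<=` I -> ~ I 1 -> I = M].

Definition noetherian : Prop :=
  forall I : set A, ideal I -> exists s : seq A, I = ideal_gen [set` s].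

(* A is local with maximal ideal M. *)
Definition local_ring (M : set A) : Prop :=
  maximal_ideal M /\ forall N, maximal_ideal N -> N = M.

Definition quotring (X : set A) := quotmod (X : set A^o).

Variable X : set A.

HB.instance Definition _ := GRing.Zmodule.on (quotring X).

Definition qrpi (x : A) : quotring X := qpi (X : set A^o) x.

Definition qmul (x y : quotring X) : quotring X := qrpi (repr x * repr y).

Lemma qmulE x y : qmul (qrpi x) (qrpi y) = qrpi (x * y).
Proof.
apply/qpiP; set x' := repr _; set y' := repr _.
have -> : x' * y' - x * y = (x' : A) *: ((y' : A^o) - y) + (y : A) *: ((x' : A^o) - x).
  rewrite -[_ *: _]/(x' * (y' - y)) -[y *: _]/(y * (x' - x)).
  by rewrite !mulrBr ![y * _]mulrC addrA subrK.
by apply: lspanP; [|apply: lspanZ]; apply: qrepr.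
Qed.

Lemma qrpi_ind (P : quotring X -> Prop) : (forall x, P (qrpi x)) -> forall x, P x.
Proof. exact: (@qpi_ind A A^o X P). Qed.

Lemma qrpiD : {morph qrpi : x y / x + y}.
Proof. exact: (raddfD (qpi (X : set A^o))). Qed.

Fact qmulA : associative qmul.
Proof.
by elim/qrpi_ind=> x; elim/qrpi_ind=> y; elim/qrpi_ind=> z; rewrite !qmulE mulrA.
Qed.

Fact qmulC : commutative qmul.
Proof. by elim/qrpi_ind=> x; elim/qrpi_ind=> y; rewrite !qmulE mulrC. Qed.

Fact qmul1 : left_id (qrpi 1) qmul.
Proof. by elim/qrpi_ind=> x; rewrite qmulE mul1r. Qed.

Fact qmulDl : left_distributive qmul +%R.
Proof.
elim/qrpi_ind=> x; elim/qrpi_ind=> y; elim/qrpi_ind=> z.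
by rewrite -qrpiD !qmulE -qrpiD mulrDl.
Qed.

HB.instance Definition _ :=
  GRing.Zmodule_isComPzRing.Build (quotring X) qmulA qmulC qmul1 qmulDl.

Fact qrpi_zmod_morphism : zmod_morphism qrpi.
Proof. exact: (raddfB (qpi (X : set A^o))). Qed.

Fact qrpi_monoid_morphism : monoid_morphism qrpi.
Proof. by split=> [//|x y]; rewrite -qmulE. Qed.

HB.instance Definition _ :=
  GRing.isZmodMorphism.Build A (quotring X) qrpi qrpi_zmod_morphism.
HB.instance Definition _ :=
  GRing.isMonoidMorphism.Build A (quotring X) qrpi qrpi_monoid_morphism.

End Ideals.

Section TotalFractions.
Variable R : comPzRingType.

Definition fracpair := {x : R * R | `[< GRing.lreg x.2 >]}.

Lemma fracpairP (x : fracpair) : GRing.lreg (\val x).2.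
Proof. by case: x => x /= /asboolP. Qed.

Definition mkfrac (a s : R) (sreg : GRing.lreg s) : fracpair :=
  exist _ (a, s) (introT (asboolP (GRing.lreg s)) sreg).

Definition freq : rel fracpair :=
  fun x y => (\val x).1 * (\val y).2 == (\val y).1 * (\val x).2.

Fact freq_refl : reflexive freq.
Proof. by move=> x; apply: eqxx. Qed.

Fact freq_sym : symmetric freq.
Proof. by move=> x y; apply: eq_sym. Qed.

Fact freq_trans : transitive freq.
Proof.
move=> y x z /eqP xy /eqP yz; apply/eqP; apply: (fracpairP (x := y)).
by rewrite mulrA [_ * (\val x).1]mulrC xy mulrAC yz mulrAC mulrC mulrA.
Qed.

Canonical freq_equiv := EquivRel freq freq_refl freq_sym freq_trans.

(* The total ring of fractions, of fractions a/s with s a non-zero-divisor;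
   as s is regular, a/s = b/t amounts to a t = b s. *)
Definition totfrac := {eq_quot freq}.

HB.instance Definition _ : EqQuotient _ freq totfrac := EqQuotient.on totfrac.
HB.instance Definition _ := Choice.on totfrac.

Definition tfrac (a s : R) (sreg : GRing.lreg s) : totfrac :=
  \pi_totfrac (mkfrac a sreg).

Lemma fracP a s b t (sreg : GRing.lreg s) (treg : GRing.lreg t) :
  tfrac a sreg = tfrac b treg <-> a * t = b * s.
Proof.
have E : (tfrac a sreg == tfrac b treg) = (a * t == b * s) by rewrite /tfrac eqmodE.
by split=> [ab|ab]; apply/eqP; [rewrite -E ab|rewrite E ab].
Qed.

Lemma frac_ind (P : totfrac -> Prop) :
  (forall a s (sreg : GRing.lreg s), P (tfrac a sreg)) -> forall x, P x.
Proof.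
move=> H; elim/quotW=> -[[a s] /= sreg].
have := H a s (elimT (asboolP (GRing.lreg s)) sreg).
by congr P; congr (\pi_totfrac _); apply: val_inj.
Qed.

Definition tnum (x : totfrac) : R := (\val (repr x)).1.
Definition tden (x : totfrac) : R := (\val (repr x)).2.

Lemma den_reg x : GRing.lreg (tden x).
Proof. exact: fracpairP. Qed.

Arguments den_reg : clear implicits.

Lemma num_den x : tfrac (tnum x) (den_reg x) = x.
Proof.
rewrite -[RHS]reprK; congr (\pi_totfrac _); apply: val_inj.
by rewrite /= -surjective_pairing.
Qed.

Lemma num_frac a s (sreg : GRing.lreg s) :
  tnum (tfrac a sreg) * s = a * tden (tfrac a sreg).
Proof. by have /fracP := num_den (tfrac a sreg). Qed.

Definition fadd (x y : totfrac) : totfrac :=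
  tfrac (tnum x * tden y + tnum y * tden x) (lregM (den_reg x) (den_reg y)).
Definition fopp (x : totfrac) : totfrac := tfrac (- tnum x) (den_reg x).
Definition fmul (x y : totfrac) : totfrac :=
  tfrac (tnum x * tnum y) (lregM (den_reg x) (den_reg y)).

Lemma faddE a s b t (sreg : GRing.lreg s) (treg : GRing.lreg t) :
  fadd (tfrac a sreg) (tfrac b treg) = tfrac (a * t + b * s) (lregM sreg treg).
Proof.
apply/fracP; set x := tfrac a sreg; set y := tfrac b treg.
rewrite !mulrDl; congr (_ + _).
  by rewrite mulrACA num_frac (AC (2*2) (1*4*(2*3))).
by rewrite [s * t]mulrC mulrACA num_frac (AC (2*2) (1*4*(3*2))).
Qed.

Lemma foppE a s (sreg : GRing.lreg s) : fopp (tfrac a sreg) = tfrac (- a) sreg.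
Proof. by apply/fracP; rewrite !mulNr num_frac. Qed.

Lemma fmulE a s b t (sreg : GRing.lreg s) (treg : GRing.lreg t) :
  fmul (tfrac a sreg) (tfrac b treg) = tfrac (a * b) (lregM sreg treg).
Proof. by apply/fracP; rewrite mulrACA !num_frac mulrACA. Qed.

Definition fof (a : R) : totfrac := tfrac a (@lreg1 R).

Fact faddA : associative fadd.
Proof.
elim/frac_ind=> a s rs; elim/frac_ind=> b t rt; elim/frac_ind=> c u ru.
rewrite !faddE; apply/fracP; congr (_ * _); last by rewrite mulrA.
rewrite !mulrDl addrA; congr (_ + _); last by rewrite -mulrA [t * s]mulrC.
by rewrite mulrA [b * u * s]mulrAC.
Qed.

Fact faddC : commutative fadd.
Proof.
elim/frac_ind=> a s rs; elim/frac_ind=> b t rt.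
by rewrite !faddE; apply/fracP; rewrite addrC [s * t]mulrC.
Qed.

Fact fadd0 : left_id (fof 0) fadd.
Proof.
by elim/frac_ind=> a s rs; rewrite faddE; apply/fracP;
  rewrite mul0r add0r mulr1 mul1r.
Qed.

Fact faddN : left_inverse (fof 0) fopp fadd.
Proof.
by elim/frac_ind=> a s rs; rewrite foppE faddE; apply/fracP;
  rewrite mulNr addNr !mul0r.
Qed.

HB.instance Definition _ := GRing.isZmodule.Build totfrac faddA faddC fadd0 faddN.

Fact fmulA : associative fmul.
Proof.
elim/frac_ind=> a s rs; elim/frac_ind=> b t rt; elim/frac_ind=> c u ru.
by rewrite !fmulE; apply/fracP; rewrite !mulrA.
Qed.

Fact fmulC : commutative fmul.
Proof.
elim/frac_ind=> a s rs; elim/frac_ind=> b t rt.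
by rewrite !fmulE; apply/fracP; rewrite [a * b]mulrC [s * t]mulrC.
Qed.

Fact fmul1 : left_id (fof 1) fmul.
Proof.
by elim/frac_ind=> a s rs; rewrite fmulE; apply/fracP; rewrite !mul1r.
Qed.

Fact fmulDl : left_distributive fmul +%R.
Proof.
elim/frac_ind=> a s rs; elim/frac_ind=> b t rt; elim/frac_ind=> c u ru.
rewrite -[_ + _]/(fadd _ _) -[RHS]/(fadd _ _) !(faddE, fmulE); apply/fracP.
rewrite !mulrDl; congr (_ + _).
  by rewrite (AC (3*(2*2)) ((1*3*(2*5))*((4*6)*7))).
by rewrite (AC (3*(2*2)) ((1*3*(2*5))*((4*6)*7))).
Qed.

HB.instance Definition _ :=
  GRing.Zmodule_isComPzRing.Build totfrac fmulA fmulC fmul1 fmulDl.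

Fact fof_zmod_morphism : zmod_morphism fof.
Proof.
move=> a b; rewrite -[RHS]/(fadd _ (fopp _)) foppE faddE; apply/fracP.
by rewrite !mulr1.
Qed.

Fact fof_monoid_morphism : monoid_morphism fof.
Proof.
split=> [//|a b]; rewrite -[RHS]/(fmul _ _) fmulE; apply/fracP.
by rewrite !mulr1.
Qed.

HB.instance Definition _ :=
  GRing.isZmodMorphism.Build R totfrac fof fof_zmod_morphism.
HB.instance Definition _ :=
  GRing.isMonoidMorphism.Build R totfrac fof fof_monoid_morphism.

End TotalFractions.

Section FreeModule.
Variables (R : comNzRingType) (K : choiceType) (W : lmodType R) (h : K -> W).

Definition mgen (k : K) : malg K R := mkmalgU k 1.

(* The linear map from the free module on K extending h. *)
Definition malglift (g : malg K R) : W :=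
  \sum_(k <- finmap.enum_fset (msupp g)) mcoeff k g *: h k.

Lemma malgliftEw (d : finmap.finset_of (Phant K)) (g : malg K R) :
  finmap.fsubset (msupp g) d ->
  malglift g = \sum_(k <- finmap.enum_fset d) mcoeff k g *: h k.
Proof.
move=> gd; apply: finmap.big_fset_incl => // k kd kg.
by rewrite mcoeff_outdom // scale0r.
Qed.

Lemma malglift_mgen k : malglift (mgen k) = h k.
Proof.
rewrite (malgliftEw msuppU_le) finmap.big_seq_fset1.
by rewrite mcoeffUU scale1r.
Qed.

Fact malglift_linear : linear malglift.
Proof.
move=> a g1 g2.
pose d := finmap.fsetU (msupp g1) (msupp g2).
have d1 : finmap.fsubset (msupp g1) d by apply: finmap.fsubsetUl.
have d2 : finmap.fsubset (msupp g2) d by apply: finmap.fsubsetUr.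
have d3 : finmap.fsubset (msupp (a *: g1 + g2)) d.
  apply: (finmap.fsubset_trans (msuppD_le _ _)).
  by apply: finmap.fsetSU; apply: msuppZ_le.
rewrite (malgliftEw d1) (malgliftEw d2) (malgliftEw d3).
rewrite scaler_sumr -big_split; apply: eq_bigr => k _ /=.
by rewrite mcoeffD mcoeffZ scalerDl scalerA.
Qed.

HB.instance Definition _ :=
  GRing.isLinear.Build R (malg K R) W _ malglift malglift_linear.

Lemma malg_ind (P : malg K R -> Prop) :
  P 0 -> (forall a k g, P g -> P (a *: mgen k + g)) -> forall g, P g.
Proof.
move=> P0 PD g; rewrite [g]monalgE; elim/big_rec: _ => // k g' _.
by move=> /(PD (mcoeff k g) k); congr (P (_ + _)); apply/malgP => l;
  rewrite mcoeffZ !mcoeffU mulrnAr mulr1.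
Qed.

End FreeModule.

Arguments mgen R {K} k.

Section Tensor.
Variables (R : comNzRingType) (M N : lmodType R).

Definition tensor_rel : set (malg (M * N)%type R) :=
  [set g | (exists a x y n,
             g = mgen R (a *: x + y, n) - (a *: mgen R (x, n) + mgen R (y, n)))
        \/ (exists a m x y,
             g = mgen R (m, a *: x + y) - (a *: mgen R (m, x) + mgen R (m, y)))].

Definition tensor := quotmod tensor_rel.

HB.instance Definition _ := GRing.Lmodule.on tensor.

Definition tens (x : M) (y : N) : tensor := qpi tensor_rel (mgen R (x, y)).

Lemma tensPl a x y n : tens (a *: x + y) n = a *: tens x n + tens y n.
Proof.
rewrite /tens -linearP; apply/qpiP; apply: sub_lspan; left.
by exists a, x, y, n.
Qed.

Lemma tensPr a m x y : tens m (a *: x + y) = a *: tens m x + tens m y.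
Proof.
rewrite /tens -linearP; apply/qpiP; apply: sub_lspan; right.
by exists a, m, x, y.
Qed.

Lemma tens0l n : tens 0 n = 0.
Proof. by have := tensPl (-1) 0 0 n; rewrite scaler0 addr0 scaleN1r addNr. Qed.

Lemma tens0r m : tens m 0 = 0.
Proof. by have := tensPr (-1) m 0 0; rewrite scaler0 addr0 scaleN1r addNr. Qed.

Lemma tensDl x y n : tens (x + y) n = tens x n + tens y n.
Proof. by have := tensPl 1 x y n; rewrite !scale1r. Qed.

Lemma tensDr m x y : tens m (x + y) = tens m x + tens m y.
Proof. by have := tensPr 1 m x y; rewrite !scale1r. Qed.

Lemma tensZl a x n : tens (a *: x) n = a *: tens x n.
Proof. by have := tensPl a x 0 n; rewrite tens0l !addr0. Qed.

Lemma tensZr a m x : tens m (a *: x) = a *: tens m x.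
Proof. by have := tensPr a m x 0; rewrite tens0r !addr0. Qed.

Lemma tensor_ind (P : tensor -> Prop) :
  P 0 -> (forall x y t, P t -> P (tens x y + t)) -> forall t, P t.
Proof.
move=> P0 PD; elim/qpi_ind; elim/malg_ind => [|a [x y] g Pg]; first by rewrite raddf0.
have -> : qpi tensor_rel (a *: mgen R (x, y) + g) = tens (a *: x) y + qpi _ g.
  by rewrite tensZl /tens linearP.
exact: PD.
Qed.

Section Lift.
Variables (W : lmodType R) (h : M -> N -> W).
Hypothesis hl : forall n, linear (h^~ n).
Hypothesis hr : forall m, linear (h m).

Fact tensor_rel_ker g :
  tensor_rel g -> malglift (fun p : M * N => h p.1 p.2) g = 0.
Proof.
case=> [[a [x [y [n ->]]]]|[a [m [x [y ->]]]]];
  rewrite raddfB /= malglift_linear !malglift_mgen /=.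
  by rewrite (hl n a x y) subrr.
by rewrite (hr m a x y) subrr.
Qed.

Definition tensor_lift : tensor -> W :=
  quotlift (X := tensor_rel) (malglift (fun p : M * N => h p.1 p.2)).

Lemma tensor_lift_tens x y : tensor_lift (tens x y) = h x y.
Proof. by rewrite /tensor_lift (quotlift_qpi tensor_rel_ker) /= malglift_mgen. Qed.

Lemma tensor_lift_linear : linear tensor_lift.
Proof. exact: quotlift_linear tensor_rel_ker. Qed.

Lemma tensor_liftD s t : tensor_lift (s + t) = tensor_lift s + tensor_lift t.
Proof. by have := tensor_lift_linear 1 s t; rewrite !scale1r. Qed.

Lemma tensor_lift0 : tensor_lift 0 = 0.
Proof. by apply: (addrI (tensor_lift 0)); rewrite -tensor_liftD !addr0. Qed.

End Lift.
End Tensor.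

Section ExtensionOfScalars.
Variables (R : comNzRingType) (B : comPzRingType) (g : {rmorphism R -> B}).
Variable M : lmodType R.

(* M (x)_R B as a B-module, B acting on the right-hand factor. *)
Definition extscal := tensor M (resmod g).

HB.instance Definition _ := GRing.Zmodule.on extscal.

Let scl (b : B) (x : M) (c : resmod g) : tensor M (resmod g) :=
  tens x ((b : resmod g) * c).

Fact scl_l b c : linear (scl b ^~ c).
Proof. by move=> a x y; rewrite /scl tensPl. Qed.

Fact scl_r b x : linear (scl b x).
Proof. by move=> a c d; rewrite /scl mulrDr -resscaleAr tensPr. Qed.

Definition extscale (b : B) (t : extscal) : extscal := tensor_lift (scl b) t.

Lemma extscale_tens b x c : extscale b (tens x c) = tens x ((b : resmod g) * c).
Proof. by rewrite /extscale tensor_lift_tens //; [apply: scl_l|apply: scl_r]. Qed.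

Lemma extscaleD b : {morph extscale b : s t / s + t}.
Proof. by move=> s t; apply: tensor_liftD; [apply: scl_l|apply: scl_r]. Qed.

Lemma extscale0 b : extscale b 0 = 0.
Proof. by apply: tensor_lift0; [apply: scl_l|apply: scl_r]. Qed.

Fact extscaleA a b t : extscale a (extscale b t) = extscale (a * b) t.
Proof.
elim/tensor_ind: t => [|x c t IHt]; first by rewrite !extscale0.
by rewrite !extscaleD IHt !extscale_tens mulrA.
Qed.

Fact extscale1 : left_id 1 extscale.
Proof.
elim/tensor_ind=> [|x c t IHt]; first by rewrite extscale0.
by rewrite extscaleD IHt extscale_tens mul1r.
Qed.

Fact extscaleDr : right_distributive extscale +%R.
Proof. exact: extscaleD. Qed.

Fact extscaleDl t : {morph extscale^~ t : a b / a + b}.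
Proof.
move=> a b; elim/tensor_ind: t => [|x c t IHt]; first by rewrite !extscale0 addr0.
by rewrite !extscaleD IHt !extscale_tens mulrDl tensDr addrACA.
Qed.

HB.instance Definition _ := GRing.Zmodule_isLmodule.Build B extscal
  extscaleA extscale1 extscaleDr extscaleDl.

End ExtensionOfScalars.

Section TensorAlgebra.
Variables (R : comNzRingType) (A B : comPzRingType).
Variables (f : {rmorphism R -> A}) (g : {rmorphism R -> B}).

(* The R-algebra A (x)_R B, with (a (x) b) (a' (x) b') = aa' (x) bb'. *)
Definition tensalg := tensor (resmod f) (resmod g).

HB.instance Definition _ := GRing.Zmodule.on tensalg.

Let mul1 (a : resmod f) (b : resmod g) (c : resmod f) (d : resmod g) : tensalg :=
  tens (a * c) (b * d).

Fact mul1_l a b d : linear (fun c => mul1 a b c d).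
Proof. by move=> r x y; rewrite /mul1 mulrDr -resscaleAr tensPl. Qed.

Fact mul1_r a b c : linear (mul1 a b c).
Proof. by move=> r x y; rewrite /mul1 mulrDr -resscaleAr tensPr. Qed.

Let mul2 (t : tensalg) (a : resmod f) (b : resmod g) : tensalg :=
  tensor_lift (mul1 a b) t.

Fact mul2E a b c d : mul2 (tens c d) a b = tens (a * c) (b * d).
Proof. by rewrite /mul2 tensor_lift_tens //; [apply: mul1_l|apply: mul1_r]. Qed.

Fact mul2D s t a b : mul2 (s + t) a b = mul2 s a b + mul2 t a b.
Proof. by apply: tensor_liftD; [apply: mul1_l|apply: mul1_r]. Qed.

Fact mul20 a b : mul2 0 a b = 0.
Proof. by apply: tensor_lift0; [apply: mul1_l|apply: mul1_r]. Qed.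

Fact mul2_l t b : linear (fun a => mul2 t a b : tensor _ _).
Proof.
move=> r x y; elim/tensor_ind: t => [|c d t IHt].
  by rewrite !mul20 scaler0 addr0.
by rewrite !mul2D IHt !mul2E mulrDl -resscaleAl tensPl scalerDr addrACA.
Qed.

Fact mul2_r t a : linear (mul2 t a : _ -> tensor _ _).
Proof.
move=> r x y; elim/tensor_ind: t => [|c d t IHt].
  by rewrite !mul20 scaler0 addr0.
by rewrite !mul2D IHt !mul2E mulrDl -resscaleAl tensPr scalerDr addrACA.
Qed.

Definition tmul (s t : tensalg) : tensalg := tensor_lift (mul2 t) s.

Lemma tmul_tens a b t : tmul (tens a b) t = mul2 t a b.
Proof. exact: (tensor_lift_tens (mul2_l t) (mul2_r t)). Qed.

Lemma tmulE a b c d : tmul (tens a b) (tens c d) = tens (a * c) (b * d).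
Proof. by rewrite tmul_tens mul2E. Qed.

Fact tmulDl : left_distributive tmul +%R.
Proof. by move=> s t u; exact: (tensor_liftD (mul2_l u) (mul2_r u) s t). Qed.

Fact tmul0l t : tmul 0 t = 0.
Proof. exact: (tensor_lift0 (mul2_l t) (mul2_r t)). Qed.

Fact tmul_tensDr a b s t :
  tmul (tens a b) (s + t) = tmul (tens a b) s + tmul (tens a b) t.
Proof.
by rewrite !tmul_tens mul2D.
Qed.

Fact tmulDr : right_distributive tmul +%R.
Proof.
move=> s t u; elim/tensor_ind: s => [|a b s IHs]; first by rewrite !tmul0l addr0.
rewrite (tmulDl _ s (t + u)) (tmulDl _ s t) (tmulDl _ s u) IHs tmul_tensDr.
exact: addrACA.
Qed.

Fact tmul0r t : tmul t 0 = 0.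
Proof. by apply: (addrI (tmul t 0)); rewrite -tmulDr !addr0. Qed.

Fact tmul_tensC a b t : tmul (tens a b) t = tmul t (tens a b).
Proof.
elim/tensor_ind: t => [|c d t IHt]; first by rewrite tmul0l tmul0r.
rewrite (tmulDl (tens c d) t) (tmulDr _ (tens c d) t) IHt !tmulE.
by rewrite [a * c]mulrC [b * d]mulrC.
Qed.

Fact tmulC : commutative tmul.
Proof.
elim/tensor_ind=> [t|a b s IHs t]; first by rewrite tmul0l tmul0r.
by rewrite (tmulDl (tens a b) s t) (tmulDr t (tens a b) s) IHs tmul_tensC.
Qed.

Fact tmul_tens2A a b c d t :
  tmul (tens a b) (tmul (tens c d) t) = tmul (tens (a * c) (b * d)) t.
Proof.
elim/tensor_ind: t => [|x y t IHt]; first by rewrite !tmul0r.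
rewrite (tmulDr (tens c d) (tens x y) t) (tmulDr (tens a b) _ (tmul _ t)).
by rewrite (tmulDr _ (tens x y) t) IHt !tmulE !mulrA.
Qed.

Fact tmul_tensA a b s t :
  tmul (tens a b) (tmul s t) = tmul (tmul (tens a b) s) t.
Proof.
elim/tensor_ind: s => [|c d s IHs]; first by rewrite tmul0l tmul0r tmul0l.
rewrite (tmulDl (tens c d) s t) (tmulDr _ _ (tmul s t)) (tmulDr _ _ s).
by rewrite (tmulDl _ (tmul _ s) t) IHs tmul_tens2A tmulE.
Qed.

Fact tmulA : associative tmul.
Proof.
elim/tensor_ind=> [s t|a b u IHu s t]; first by rewrite !tmul0l.
rewrite (tmulDl (tens a b) u (tmul s t)) (tmulDl (tens a b) u s).
by rewrite (tmulDl _ (tmul u s) t) IHu tmul_tensA.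
Qed.

Fact tmul1 : left_id (tens (1 : resmod f) (1 : resmod g)) tmul.
Proof.
elim/tensor_ind=> [|a b s IHs]; first by rewrite tmul0r.
by rewrite (tmulDr _ (tens a b) s) IHs tmulE !mul1r.
Qed.

HB.instance Definition _ :=
  GRing.Zmodule_isComPzRing.Build tensalg tmulA tmulC tmul1 tmulDl.

End TensorAlgebra.

Section Modules.
Variable R : comNzRingType.

Definition lin_iso (A : pzRingType) (U V : lmodType A) : Prop :=
  exists f : {linear U -> V}, bijective f.

Definition finitely_generated (M : lmodType R) : Prop :=
  exists s : seq M, lspan [set` s] = [set: M].

Definition torsion (M : lmodType R) : set M :=
  [set x | exists2 r : R, GRing.lreg r & r *: x = 0].

Arguments torsion : clear implicits.

Definition torsionfree (M : lmodType R) : Prop := torsion M = [set 0].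

(* Freeness for finitely generated modules: a basis is then finite. *)
Definition free_module (M : lmodType R) : Prop :=
  exists n : nat, lin_iso M 'rV[R]_n.

Definition has_rank (M : lmodType R) (e : nat) : Prop :=
  lin_iso (extscal (@fof R) M) 'rV[totfrac R]_e.

Definition annihilator (M : lmodType R) : set R :=
  [set a | forall x : M, a *: x = 0].

Definition ext_rel (n : nat) (M : lmodType R) : set (malg {ffun 'I_n -> M} R) :=
  [set g | (exists (i : 'I_n) (a : R) (u v w : {ffun 'I_n -> M}),
             [/\ forall j, j != i -> u j = w j /\ v j = w j,
                 w i = a *: u i + v i &
                 g = mgen R w - (a *: mgen R u + mgen R v)])
        \/ (exists (i j : 'I_n) (u : {ffun 'I_n -> M}),
             [/\ i != j, u i = u j & g = mgen R u])].

Arguments ext_rel : clear implicits.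

(* The n-th exterior power: the free module on M^n modulo the relations making
   (u_1, .., u_n) |-> u_1 /\ .. /\ u_n multilinear and alternating. *)
Definition exterior_power (n : nat) (M : lmodType R) := quotmod (ext_rel n M).

HB.instance Definition _ n M := GRing.Lmodule.on (exterior_power n M).

Definition sym_rel (M : lmodType R) : set (malg (cmonom M) R) :=
  [set p | exists (a : R) (x y : M),
     p = mgen R (ucm (a *: x + y)) - (a *: mgen R (ucm x) + mgen R (ucm y))].

Arguments sym_rel : clear implicits.

(* The symmetric algebra: the polynomial ring R[X_x : x in M] (whose monomials
   are `cmonom M`, with X_x = `ucm x`) modulo X_(ax + y) = a X_x + X_y. *)
Definition sym (M : lmodType R) := quotring (sym_rel M).

HB.instance Definition _ M := GRing.ComPzRing.on (sym M).

Definition sym_str (M : lmodType R) : {rmorphism R -> sym M} :=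
  qrpi (sym_rel M) \o in_alg (malg (cmonom M) R).

Definition rees (M : lmodType R) := quotring (torsion (resmod (sym_str M))).

HB.instance Definition _ M := GRing.ComPzRing.on (rees M).

Definition rees_str (M : lmodType R) : {rmorphism R -> rees M} :=
  qrpi (torsion (resmod (sym_str M)) : set (sym M)) \o sym_str M.

(* R(M) (x)_R k, where k = R/m. *)
Definition fiber_cone (m : set R) (M : lmodType R) :=
  tensalg (rees_str M) (qrpi m).

HB.instance Definition _ m M := GRing.ComPzRing.on (fiber_cone m M).

End Modules.

Section Dimension.
Variable A : comPzRingType.

(* c 0 < c 1 < .. < c n is a chain of primes, of length n. *)
Definition prime_chain (n : nat) (c : nat -> set A) : Prop :=
  (forall i, (i <= n)%N -> prime_ideal (c i)) /\
  (forall i, (i < n)%N -> c i `<` c i.+1).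

(* Every subset of \bar int has a supremum and an infimum there. *)
Definition krull_dim : \bar int :=
  supremum -oo%E
    [set (n%:Z)%:E | n in [set n : nat | exists c, prime_chain n c]].

Definition height_prime (P : set A) : \bar int :=
  supremum -oo%E
    [set (n%:Z)%:E | n in
      [set n : nat | exists c, prime_chain n c /\ c n = P]].

Definition height (I : set A) : \bar int :=
  infimum +oo%E
    [set height_prime P | P in [set P | prime_ideal P /\ I `<=` P]].

Definition regular_seq (s : seq A) : Prop :=
  ~ ideal_gen [set` s] 1 /\
  forall i, (i < size s)%N -> forall x : A,
    ideal_gen [set` take i s] (s`_i * x) -> ideal_gen [set` take i s] x.

Definition grade_ideal (I : set A) : \bar int :=
  if `[< I 1 >] then +oo%E else
  supremum -oo%E
    [set ((size s)%:Z)%:E | s in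
      [set s : seq A | regular_seq s /\ [set` s] `<=` I]].

End Dimension.

Section Invariants.
Variable R : comNzRingType.

Definition analytic_spread (m : set R) (M : lmodType R) : \bar int :=
  krull_dim (fiber_cone m M).

Definition grade (M : lmodType R) : \bar int := grade_ideal (annihilator M).

(* Matrices act on row vectors: phi : R^p -> R^n is the map w |-> w *m phi. *)
Definition presents (n p : nat) (phi : 'M[R]_(p, n)) (M : lmodType R) : Prop :=
  exists f : {linear 'rV[R]_n -> M},
    (forall x, exists v, f v = x) /\
    (forall v, f v = 0 <-> exists w : 'rV[R]_p, v = w *m phi).

Definition minors_ideal (t n p : nat) (phi : 'M[R]_(p, n)) : set R :=
  ideal_gen [set d | exists (r : 'I_t -> 'I_p) (c : 'I_t -> 'I_n),
    [/\ injective r, injective c & d = \det (mxsub r c phi)]].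

(* By Fitting's lemma I_(n-i)(phi) does not depend on the presentation; the
   truncated subtraction gives I_0 = R for i >= n. *)
Definition fitting_ideal (i : nat) (M : lmodType R) : set R :=
  [set a | exists (n p : nat) (phi : 'M[R]_(p, n)),
     presents phi M /\ minors_ideal (n - i) phi a].

(* The module G / E for an embedding iota : E -> G. *)
Definition quot_by (E G : lmodType R) (iota : {linear E -> G}) :=
  quotmod (range iota).

HB.instance Definition _ (E G : lmodType R) (iota : {linear E -> G}) :=
  GRing.Lmodule.on (quot_by iota).

(* E, embedded by iota in the free module G, is an ideal module. *)
Definition ideal_module (E G : lmodType R) (iota : {linear E -> G}) : Prop :=
  [/\ torsionfree E, free_module G, injective iota &
      (2%:Z%:E <= grade (quot_by iota))%E].

End Invariants.

(* Main.v *)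
(* Let I be the image of the e-th exterior power of E in that of G, which is R:
   the ideal of maximal minors of the coordinates of elements of E. Sending w to
   (det w) t maps the Rees algebra of the exterior power onto R[It], so chains of
   homogeneous primes of R[It] containing m give chains in the fiber cone.
   If no such chain has length h, prime avoidance yields fewer than h homogeneous
   elements that generate some I^N modulo m I^N, hence I^N by Nakayama; by Krull's
   height theorem some prime P containing I has height less than h. Such a P contains both
   Fitting ideals: a minor d of a presentation of G/E satisfies d G <= E, so
   d^e lies in I; and if a minor for F_e(E) were outside P, then E would be free
   at P and grade G/E >= 2 would force the determinant of E -> G to be a unit there. *)

(* All primes of R[It] in play are homogeneous, so R[It] appears only as a subset of R[t]: a
   homogeneous ideal is a sequence of ideals of R, and Noetherian induction on such sequences is
   borrowed from a polynomial ring mapping onto R[It]. Strict inclusions of primes survive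
   contraction along a surjection, which carries chains from R[It] back to the Rees algebra. The
   chain of length h grows from homogeneous f_1, .., f_h of positive degree, chosen so that every
   homogeneous prime containing m and f_1, .., f_j ends a chain of length j. Prime avoidance picks
   f_(j+1) outside those primes of a finite list over (m, f_1, .., f_j) that do not contain It. The
   choice fails only if every prime of the list contains It; then a power of It falls into (m, f_1,
   .., f_j) with j < h, the case settled by Nakayama and Krull. Otherwise m + It + I^2 t^2 + ..
   contains all the f's and ends the chain. *)
Require Import Defs.
From HB Require Import structures.
From mathcomp Require Import all_boot all_order fingroup perm all_algebra generic_quotient.
From mathcomp Require Import finmap.
From mathcomp Require Import boolp classical_sets functions constructive_ereal.
From mathcomp.multinomials Require Import -(notations) monalg.

Import Order.TTheory GRing.Theory Num.Theory.
Local Open Scope classical_set_scope.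
Local Open Scope ring_scope.

Set Implicit Arguments.
Unset Strict Implicit.
Unset Printing Implicit Defensive.

(** * Ideals *)

Section IdealTheory.
Variable A : comPzRingType.
Implicit Types (I J K P Q : set A) (a b x y : A).

Lemma ideal_zero I : ideal I -> I 0.
Proof. by case. Qed.

Lemma ideal_add I x y : ideal I -> I x -> I y -> I (x + y).
Proof.
by case=> _ H Ix Iy; have := H 1 x y Ix Iy; rewrite -[_ *: _]/(1 * x) mul1r.
Qed.

Lemma ideal_mull I a x : ideal I -> I x -> I (a * x).
Proof. by move=> idI Ix; have := idI.2 a x 0 Ix (ideal_zero idI); rewrite addr0. Qed.

Lemma ideal_mulr I a x : ideal I -> I x -> I (x * a).
Proof. by rewrite mulrC; exact: ideal_mull. Qed.

Lemma ideal_opp I x : ideal I -> I x -> I (- x).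
Proof. by rewrite -mulN1r; exact: ideal_mull. Qed.

Lemma ideal_sub I x y : ideal I -> I x -> I y -> I (x - y).
Proof. by move=> idI Ix Iy; apply: ideal_add => //; apply: ideal_opp. Qed.

Lemma ideal_bigsum I (T : Type) (r : seq T) (p : pred T) (F : T -> A) :
  ideal I -> (forall i, p i -> I (F i)) -> I (\sum_(i <- r | p i) F i).
Proof.
move=> idI IF; apply: (big_ind I) => //; first exact: ideal_zero.
by move=> x y; apply: ideal_add.
Qed.

Lemma ideal_intro I : I 0 -> (forall x y, I x -> I y -> I (x + y)) ->
  (forall a x, I x -> I (a * x)) -> ideal I.
Proof. by move=> I0 ID IM; split=> // a x y Ix Iy; apply: ID => //; apply: IM. Qed.

Lemma ideal_one I x : ideal I -> I 1 -> I x.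
Proof. by move=> idI /(ideal_mull x idI); rewrite mulr1. Qed.

Lemma ideal_ideal_gen (X : set A) : ideal (ideal_gen X).
Proof. exact: submodule_lspan. Qed.

Lemma sub_ideal_gen (X : set A) : X `<=` ideal_gen X.
Proof. exact: (@sub_lspan _ A^o). Qed.

Lemma ideal_gen_sub (X : set A) I : ideal I -> X `<=` I -> ideal_gen X `<=` I.
Proof. exact: (@lspan_sub _ A^o). Qed.

Lemma ideal_setT : ideal [set: A].
Proof. by []. Qed.

Lemma ideal_transporter I a : ideal I -> ideal [set x | I (a * x)].
Proof.
move=> idI; apply: ideal_intro => [|x y|b x] /=.
- by rewrite mulr0; apply: ideal_zero.
- by rewrite mulrDr; apply: ideal_add.
- by rewrite mulrCA; apply: ideal_mull.
Qed.

Lemma prime_ideal_ideal P : prime_ideal P -> ideal P.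
Proof. by case. Qed.

Lemma prime1 P : prime_ideal P -> ~ P 1.
Proof. by case. Qed.

Lemma primeM P x y : prime_ideal P -> P (x * y) -> P x \/ P y.
Proof. by case=> _ _; apply. Qed.

Lemma prime_notM P x y : prime_ideal P -> ~ P x -> ~ P y -> ~ P (x * y).
Proof. by move=> pP Px Py /(primeM pP) []. Qed.

Lemma primeX P x n : prime_ideal P -> P (x ^+ n) -> P x.
Proof.
move=> pP; elim: n => [/(prime1 pP)//|n IHn].
by rewrite exprS => /(primeM pP) [//|/IHn].
Qed.

Definition addid I J : set A := [set z | exists x y, [/\ I x, J y & z = x + y]].

Lemma ideal_addid I J : ideal I -> ideal J -> ideal (addid I J).
Proof.
move=> idI idJ; apply: ideal_intro => [|_ _ [x [y [Ix Jy ->]]] [x' [y' [Ix' Jy' ->]]]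
  |a _ [x [y [Ix Jy ->]]]].
- by exists 0, 0; rewrite addr0; split=> //; apply: ideal_zero.
- by exists (x + x'), (y + y'); rewrite addrACA; split=> //; apply: ideal_add.
- by exists (a * x), (a * y); rewrite mulrDr; split=> //; apply: ideal_mull.
Qed.

Lemma addidl I J : ideal J -> I `<=` addid I J.
Proof. by move=> idJ x Ix; exists x, 0; rewrite addr0; split=> //; apply: ideal_zero. Qed.

Lemma addidr I J : ideal I -> J `<=` addid I J.
Proof. by move=> idI x Jx; exists 0, x; rewrite add0r; split=> //; apply: ideal_zero. Qed.

Lemma addid_sub I J K : ideal K -> I `<=` K -> J `<=` K -> addid I J `<=` K.
Proof. by move=> idK IK JK _ [x [y [/IK Kx /JK Ky ->]]]; apply: ideal_add. Qed.

Lemma addidS I I' J : I `<=` I' -> addid I J `<=` addid I' J.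
Proof. by move=> II' _ [x [y [/II' ? ? ->]]]; exists x, y. Qed.

Definition princ x : set A := [set z | exists a, z = a * x].

Lemma ideal_princ x : ideal (princ x).
Proof.
apply: ideal_intro => [|_ _ [a ->] [b ->]|b _ [a ->]].
- by exists 0; rewrite mul0r.
- by exists (a + b); rewrite mulrDl.
- by exists (b * a); rewrite mulrA.
Qed.

Lemma princ_id x : princ x x.
Proof. by exists 1; rewrite mul1r. Qed.

Lemma princ_sub I x : ideal I -> I x -> princ x `<=` I.
Proof. by move=> idI Ix _ [a ->]; apply: ideal_mull. Qed.

Fixpoint ipow I (n : nat) : set A :=
  if n is n'.+1 then ideal_gen [set z | exists a b, [/\ I a, ipow I n' b & z = a * b]]
  else setT.

Lemma ideal_ipow I n : ideal (ipow I n).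
Proof. by case: n => [|n]; [apply: ideal_setT|apply: ideal_ideal_gen]. Qed.

Lemma ipowSM I n x y : I x -> ipow I n y -> ipow I n.+1 (x * y).
Proof. by move=> Ix Iy; apply: sub_ideal_gen; exists x, y. Qed.

Lemma ipow1 I : ideal I -> ipow I 1 = I.
Proof.
move=> idI; apply/seteqP; split=> [|x Ix]; last by rewrite -[x]mulr1; apply: ipowSM.
by apply: ideal_gen_sub => // _ [a [b [Ia _ ->]]]; apply: ideal_mulr.
Qed.

(** An elimination form of I^(i+j) = I^i I^j: for a generator a b of the power, the induction
    hypothesis is applied to the transporter of K by a. *)
Lemma ipowD_sub I i j K : ideal K ->
  (forall x y, ipow I i x -> ipow I j y -> K (x * y)) -> ipow I (i + j) `<=` K.
Proof.
elim: i j K => [|i IHi] j K idK H /=.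
  by move=> x Ix; rewrite -[x]mul1r; apply: H.
apply: ideal_gen_sub => // _ [a [b [Ia Ib ->]]].
apply: (IHi j _ (ideal_transporter a idK)) Ib => x y Ix Iy /=.
by rewrite mulrA; apply: H => //; apply: ipowSM.
Qed.

Lemma ipowM I i j x y : ipow I i x -> ipow I j y -> ipow I (i + j) (x * y).
Proof.
move=> Ix Iy; elim: i x Ix => [|i IHi] x.
  by move=> _; exact: (ideal_mull x (ideal_ipow I j) Iy).
rewrite mulrC; apply: (ideal_gen_sub (ideal_transporter y (ideal_ipow I (i + j).+1))).
move=> _ [a [b [Ia Ib ->]]] /=; rewrite mulrCA; apply: ipowSM => //.
by rewrite mulrC; apply: IHi.
Qed.

Lemma ipowX I x n : I x -> ipow I n (x ^+ n).
Proof. by move=> Ix; elim: n => [//|n IHn]; rewrite exprS; apply: ipowSM. Qed.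

Lemma ipow_subS I n : ideal I -> ipow I n.+1 `<=` ipow I n.
Proof.
move=> idI; apply: ideal_gen_sub; first exact: ideal_ipow.
by move=> _ [a [b [_ Ib ->]]]; apply: ideal_mull => //; exact: ideal_ipow.
Qed.

Lemma ipow_sub I n : ideal I -> (0 < n)%N -> ipow I n `<=` I.
Proof.
case: n => // n idI _; elim: n => [|n IHn]; first by rewrite ipow1.
exact: subset_trans (ipow_subS idI) IHn.
Qed.

Lemma ipow_prime I P n : prime_ideal P -> ipow I n `<=` P -> I `<=` P.
Proof. by move=> pP IP x /(ipowX n) /IP /(primeX pP). Qed.

(* The contraction to A of the extension of I to the localization at P. *)
Definition sat P I : set A := [set x | exists2 s, ~ P s & I (s * x)].

Lemma ideal_sat P I : prime_ideal P -> ideal I -> ideal (sat P I).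
Proof.
move=> pP idI; apply: ideal_intro => [|x y [s Ps Ix] [t Pt Iy]|a x [s Ps Ix]].
- by exists 1; [apply: prime1|rewrite mulr0; apply: ideal_zero].
- exists (s * t); first exact: prime_notM.
  rewrite mulrDr; apply: ideal_add => //; last by rewrite -mulrA; apply: ideal_mull.
  by rewrite mulrAC; apply: ideal_mulr.
- by exists s => //; rewrite mulrCA; apply: ideal_mull.
Qed.

Lemma sub_sat P I : prime_ideal P -> I `<=` sat P I.
Proof. by move=> pP x Ix; exists 1; [apply: prime1|rewrite mul1r]. Qed.

Lemma satS P I J : I `<=` J -> sat P I `<=` sat P J.
Proof. by move=> IJ x [s Ps /IJ]; exists s. Qed.

Lemma sat_sat P I : prime_ideal P -> sat P (sat P I) `<=` sat P I.
Proof.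
move=> pP x [s Ps [t Pt Ix]]; exists (t * s); last by rewrite -mulrA.
exact: prime_notM.
Qed.

(* A strictly ascending chain of counterexamples would have a finitely
   generated union. *)
Lemma noetherian_ind (A_noeth : noetherian A) (Pr : set A -> Prop) :
  (forall I, ideal I -> (forall J, ideal J -> I `<` J -> Pr J) -> Pr I) ->
  forall I, ideal I -> Pr I.
Proof.
move=> IH I idI; apply: contrapT => NPI.
pose bad := {J : set A | ideal J /\ ~ Pr J}.
have next (J : bad) : {K : bad | sval J `<` sval K}.
  case: J => J [idJ NPJ] /=; apply/cid; apply: contrapT => H; apply: NPJ.
  apply: IH => // K idK JK; apply: contrapT => NPK; apply: H.
  by exists (exist _ K (conj idK NPK)).
pose ch n : bad := iter n (fun J : bad => sval (next J)) (exist _ I (conj idI NPI) : bad).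
have chS n : sval (ch n) `<` sval (ch n.+1) by apply: (svalP (next (ch n))).
have chid n : ideal (sval (ch n)) := (svalP (ch n)).1.
have chle i j : (i <= j)%N -> sval (ch i) `<=` sval (ch j).
  elim: j => [|j IHj]; first by rewrite leqn0 => /eqP ->.
  rewrite leq_eqVlt => /orP [/eqP -> //|/IHj ij].
  by apply: subset_trans ij _; case: (chS j).
pose U : set A := [set x | exists n, sval (ch n) x].
have idU : ideal U.
  apply: ideal_intro => [|x y [i xi] [j yj]|a x [i xi]].
  - by exists 0%N; apply: ideal_zero.
  - exists (maxn i j); apply: ideal_add => //.
      by apply: chle xi; apply: leq_maxl.
    by apply: chle yj; apply: leq_maxr.
  - by exists i; apply: ideal_mull.
have [s Us] := A_noeth U idU.
have [N sN] : exists N, [set` s] `<=` sval (ch N).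
  have : [set` s] `<=` U by rewrite Us; apply: sub_ideal_gen.
  elim: s {Us} => [|x s IHs] sU; first by exists 0%N.
  have [i xi] : U x by apply: sU; rewrite /= mem_head.
  have [|j sj] := IHs; first by move=> y ys; apply: sU; rewrite /= inE; apply/orP; right.
  exists (maxn i j) => y; rewrite /= inE => /orP [/eqP ->|ys].
    by apply: chle xi; apply: leq_maxl.
  by apply: (chle j) (leq_maxr _ _) _ _; apply: sj.
have [_] := chS N; apply => x xN.
have : U x by exists N.+1.
by rewrite Us; apply: ideal_gen_sub.
Qed.

End IdealTheory.

(** * Krull's height theorem *)

Section LocalAlgebra.
Variables (R : comNzRingType) (R_noeth : noetherian R).
Implicit Types (I J K P Q X : set R).

(** Modulo P the matrix is diagonal: a permutation other than 1 moves some i and so contributes a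
    factor in P. *)
Lemma det_notin_prime k (B : 'M[R]_k) P : prime_ideal P ->
  (forall i, ~ P (B i i)) -> (forall i j, i != j -> P (B i j)) -> ~ P (\det B).
Proof.
move=> pP Bd Bo PB; have idP := prime_ideal_ideal pP.
have Pd : P (\prod_i B i i).
  have -> : \prod_i B i i =
      \det B - \sum_(s : 'S_k | s != 1%g) (-1) ^+ s * \prod_i B i (s i).
    rewrite /determinant (bigD1 1%g) //= odd_perm1 expr0 mul1r addrK.
    by apply: eq_bigr => i _; rewrite perm1.
  apply: ideal_sub => //; apply: ideal_bigsum => // s s1; apply: ideal_mull => //.
  have [i si] : exists i, s i != i.
    apply: contrapT => H; move/eqP: s1; apply; apply/permP => i; rewrite perm1.
    by apply: contrapT => si; apply: H; exists i; apply/eqP.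
  by rewrite (bigD1 i) //=; apply: ideal_mulr => //; apply: Bo; rewrite eq_sym.
have : ~ P (\prod_i B i i).
  apply: (big_ind (fun x => ~ P x)) => //; first exact: prime1.
  by move=> x y; apply: prime_notM.
exact.
Qed.

Definition prodid I J := ideal_gen [set z : R | exists a b, [/\ I a, J b & z = a * b]].

Lemma prodid_gen P (t : seq R) : ideal P ->
  prodid P (ideal_gen [set` t]) `<=`
  [set z | exists c : 'I_(size t) -> R, (forall j, P (c j)) /\ z = \sum_j c j * t`_j].
Proof.
move=> idP; set Z := (X in _ `<=` X).
have idZ : ideal Z.
  apply: ideal_intro => [|_ _ [c [Pc ->]] [d [Pd ->]]|a _ [c [Pc ->]]].
  - exists (fun=> 0); split=> [j|]; first exact: ideal_zero.
    by rewrite big1 // => j _; rewrite mul0r.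
  - exists (fun j => c j + d j); split=> [j|]; first exact: ideal_add.
    by rewrite -big_split; apply: eq_bigr => j _; rewrite mulrDl.
  - exists (fun j => a * c j); split=> [j|]; first exact: ideal_mull.
    by rewrite mulr_sumr; apply: eq_bigr => j _; rewrite mulrA.
apply: ideal_gen_sub => // _ [p [a [Pp Ma ->]]].
apply: (ideal_gen_sub (ideal_transporter p idZ)) Ma => x /= /(nthP 0) [i it <-].
exists (fun j => if j == Ordinal it then p else 0); split=> [j|].
  by case: eqP => // _; apply: ideal_zero.
rewrite (bigD1 (Ordinal it)) //= eqxx big1 ?addr0 // => j /negPf ->.
by rewrite mul0r.
Qed.

(* Nakayama's lemma over the localization at P, by the determinant trick. *)
Lemma nakayama P M N : prime_ideal P -> ideal M -> ideal N ->
  M `<=` sat P (addid N (prodid P M)) -> exists2 s, ~ P s & forall a, M a -> N (s * a).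
Proof.
move=> pP idM idN MN; have [t Mt] := R_noeth idM.
have idP := prime_ideal_ideal pP; set k := size t.
have tM i : M t`_i.
  have [it|it] := ltnP i (size t); last by rewrite nth_default //; apply: ideal_zero.
  by rewrite Mt; apply: sub_ideal_gen; apply/mem_nth.
have Hi (i : 'I_k) : exists snc : R * R * ('I_k -> R),
    [/\ ~ P snc.1.1, N snc.1.2, forall j, P (snc.2 j) &
        snc.1.1 * t`_i = snc.1.2 + \sum_j snc.2 j * t`_j].
  have [s Ps [n [q [Nn]]]] := MN _ (tM i).
  by rewrite Mt => /(prodid_gen idP) [c [Pc ->]] E; exists (s, n, c).
pose F i := sval (cid (Hi i)).
have FP i := svalP (cid (Hi i)).
(* The relations s_i t_i = n_i + sum_j c_ij t_j read B t = n, with n in N; [\adj B] then puts every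
   (det B) t_i in N. *)
pose B := \matrix_(i, j) ((F i).1.1 *+ (i == j) - (F i).2 j).
have BE i : \sum_j B i j * t`_j = (F i).1.2.
  have [_ _ _ E] := FP i.
  under eq_bigr do rewrite mxE mulrBl.
  rewrite sumrB (bigD1 i) //= eqxx mulr1n big1 ?addr0; last first.
    by move=> j; rewrite eq_sym => /negPf ->; rewrite mul0r.
  by rewrite -/(F i) in E; rewrite E addrK.
exists (\det B).
  apply: det_notin_prime => // [i|i j ij]; rewrite mxE ?eqxx ?(negPf ij).
    have [Ps _ Pc _] := FP i => H; apply: Ps.
    by rewrite -[X in P X](subrK ((F i).2 i)); apply: ideal_add.
  by have [_ _ Pc _] := FP i; rewrite mulr0n; apply: ideal_sub => //; apply: ideal_zero.
rewrite Mt; apply: ideal_gen_sub; first exact: ideal_transporter.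
move=> x /= /(nthP 0) [l lt <-]; pose l' := Ordinal lt.
have -> : \det B * t`_l = \sum_i (\adj B) l' i * (F i).1.2.
  have := mul_adj_mx B => /matrixP /(_ l') AB.
  under eq_bigr do rewrite -BE mulr_sumr.
  rewrite exchange_big /=.
  transitivity (\sum_j (\det B)%:M l' j * t`_j).
    rewrite (bigD1 l') //= mxE eqxx mulr1n big1 ?addr0 // => j.
    by rewrite mxE eq_sym => /negPf ->; rewrite mul0r.
  by apply: eq_bigr => j _; rewrite -AB mxE mulr_suml; apply: eq_bigr => i _; rewrite mulrA.
by apply: ideal_bigsum => // i _; apply: ideal_mull => //; case: (FP i).
Qed.

Definition minimal_over P X :=
  [/\ prime_ideal P, X `<=` P &
      forall P', prime_ideal P' -> X `<=` P' -> P' `<=` P -> P `<=` P'].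

Lemma not_prime_ideal I : ideal I -> ~ I 1 -> ~ prime_ideal I ->
  exists x y, [/\ I (x * y), ~ I x & ~ I y].
Proof.
move=> idI I1 npI; apply: contrapT => H; apply: npI; split=> // x y Ixy.
apply: contrapT => /not_orP [Ix Iy]; apply: H; by exists x, y.
Qed.

(** Locally at P, the only prime over X is P, so P is nilpotent modulo X. If x y lies in X with x, y
    outside, powers of P fall locally into X + (x) and X + (y), and the product of these two ideals
    lies in X. *)
Lemma minimal_over_ipow P X : ideal X -> minimal_over P X ->
  exists N s, ~ P s /\ forall z, ipow P N z -> X (s * z).
Proof.
move=> idX [pP]; move: X idX; apply: (noetherian_ind R_noeth) => X idX IH XP Pmin.
have [pX|npX] := pselect (prime_ideal X).
  exists 1%N, 1; split; first exact: prime1.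
  by move=> z; rewrite ipow1 ?mul1r; [apply: Pmin|case: pP].
have idP := prime_ideal_ideal pP.
have X1 : ~ X 1 by move=> /XP /(prime1 pP).
have [x [y [Xxy Xx Xy]]] := not_prime_ideal idX X1 npX.
have bigger z : ~ X z -> exists N s, ~ P s /\ forall w, ipow P N w -> addid X (princ z) (s * w).
  move=> Xz; have idXz := ideal_addid idX (ideal_princ z).
  (* For z outside P the ideal X + (z) is locally the unit ideal, so the exponent 0 and the
     multiplier z do. *)
  have [Pz|Pz] := pselect (P z); last first.
    exists 0%N, z; split=> // w _; rewrite mulrC; apply: addidr => //.
    by exists w.
  apply: IH => //.
  - split; first exact: addidl (ideal_princ z).
    by move=> H; apply: Xz; apply: H; apply: addidr => //; apply: princ_id.
  - by apply: addid_sub => //; apply: princ_sub.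
  - move=> P' pP' XP' P'P; apply: Pmin => //.
    by apply: subset_trans XP'; exact: addidl (ideal_princ z).
have [N [s [Ps sN]]] := bigger x Xx; have [M [t [Pt tM]]] := bigger y Xy.
exists (N + M)%N, (s * t); split; first exact: prime_notM.
apply: ipowD_sub; first exact: ideal_transporter.
move=> u v /sN [a [_ [Xa [c ->] E1]]] /tM [b [_ [Xb [d ->] E2]]] /=.
rewrite mulrACA E1 E2 mulrDl; apply: ideal_add => //; first exact: ideal_mulr.
rewrite mulrDr; apply: ideal_add => //; first exact: ideal_mull.
by rewrite mulrACA; apply: ideal_mull.
Qed.

(* The module R_P / X_P has finite length; the induction step passes from X to
   X + (z) for a socle element z. *)
Lemma sat_dcc P X : prime_ideal P -> ideal X -> (exists N, ipow P N `<=` X) ->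
  sat P X `<=` X -> forall J : nat -> set R,
  (forall n, ideal (J n)) -> (forall n, sat P (J n) `<=` J n) ->
  (forall n, X `<=` J n) -> (forall n, J n.+1 `<=` J n) ->
  exists n, J n `<=` J n.+1.
Proof.
move=> pP; have idP := prime_ideal_ideal pP.
move: X; apply: (noetherian_ind R_noeth) => X idX IH [N PNX] satX J idJ satJ XJ decJ.
have [X1|X1] := pselect (X 1).
  by exists 0%N => x _; apply: XJ; apply: ideal_one.
(* The socle element comes from the last power of P that is not inside X. *)
have [z [Xz Pz]] : exists z, ~ X z /\ forall p, P p -> X (p * z).
  elim: N PNX => [|N IHN] PNX; first by case: X1; apply: PNX.
  have [PN|PN] := pselect (ipow P N `<=` X); first exact: IHN.
  have [z PNz Xz] : exists2 z, ipow P N z & ~ X z.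
    apply: contrapT => H; apply: PN => z PNz; apply: contrapT => Xz; apply: H.
    by exists z.
  by exists z; split=> // p Pp; apply: PNX; apply: ipowSM.
pose X' := sat P (addid X (princ z)).
have idXz := ideal_addid idX (ideal_princ z).
have XX' : X `<=` X'.
  by apply: subset_trans (sub_sat pP); exact: addidl (ideal_princ z).
have ltXX' : X `<` X'.
  split=> // H; apply: Xz; apply: H; apply: sub_sat => //; apply: addidr => //.
  exact: princ_id.
have IH' := IH X' (ideal_sat pP idXz) ltXX'
  (ex_intro _ N (subset_trans PNX XX')) (sat_sat pP (I := _)).
have [Jz|/existsNP [n0 Jz]] := pselect (forall n, J n z).
  apply: IH' => // n; apply: subset_trans (satJ n); apply: satS.
  by apply: addid_sub => //; apply: princ_sub.
have [||n|n|n Hn] := IH' (fun n => sat P (addid (J (n0 + n)%N) (princ z))).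
- by move=> n; apply: ideal_sat => //; apply: ideal_addid => //; apply: ideal_princ.
- by move=> n; apply: sat_sat.
- by apply: satS; apply: addidS.
- by apply: satS; apply: addidS; rewrite addnS.
exists (n0 + n)%N => x Jx; rewrite -addnS.
have Jle k : J (n0 + k)%N `<=` J n0.
  elim: k => [|k IHk]; first by rewrite addn0.
  by rewrite addnS; apply: subset_trans (decJ _) IHk.
have [|s Ps [b [_ [Jb [r ->] E]]]] := Hn x.
  apply: sub_sat => //; exact: addidl (ideal_princ z) _ Jx.
apply: (satJ _); exists s => //; rewrite E; apply: ideal_add => //.
(* If r were outside P, then r z = s x - b in [J n0] and saturation would put z in [J n0]. *)
apply: XJ; apply: Pz; apply: contrapT => Pr; apply: Jz.
apply: satJ; exists r => //; have -> : r * z = s * x - b by rewrite E addrC addKr.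
by apply: ideal_sub => //; [apply: ideal_mull|] => //; apply: (Jle _); [exact: Jx|exact: Jb].
Qed.

(* Krull's principal ideal theorem in R/Q0: the symbolic powers of Q are
   eventually constant modulo x, hence constant by Nakayama. *)
Lemma krull_pit Q0 Q P x : prime_ideal Q0 -> prime_ideal Q -> Q0 `<` Q -> Q `<` P ->
  ~ minimal_over P (addid Q0 (princ x)).
Proof.
move=> pQ0 pQ [Q0Q nQQ0] [QP nPQ] mP; have [pP XP Pmin] := mP.
have idQ0 := prime_ideal_ideal pQ0; have idQ := prime_ideal_ideal pQ.
have idP := prime_ideal_ideal pP; have idx := ideal_princ x.
have Px : P x by apply: XP; apply: addidr => //; apply: princ_id.
have Qx : ~ Q x.
  by move=> Qx; apply: nPQ; apply: Pmin => //; apply: addid_sub => //; apply: princ_sub.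
(* [S n] is the preimage in R of the n-th symbolic power of Q/Q0. *)
pose Y n := addid Q0 (ipow Q n); pose S n := sat Q (Y n).
have idY n : ideal (Y n) by apply: ideal_addid => //; apply: ideal_ipow.
have idS n : ideal (S n) by apply: ideal_sat.
have decS n : S n.+1 `<=` S n.
  apply: satS => _ [a [b [Qa Qb ->]]]; exists a, b; split=> //.
  exact: ipow_subS Qb.
have Q0S n : Q0 `<=` S n.
  by apply: subset_trans (sub_sat pQ); apply: addidl; apply: ideal_ipow.
have [N [s [Ps sN]]] := minimal_over_ipow (ideal_addid idQ0 idx) mP.
have [|||||||n Sn] := @sat_dcc P (sat P (addid Q0 (princ x))) pP _ _ _
    (fun n => sat P (addid (S n) (princ x))).
- by apply: ideal_sat => //; apply: ideal_addid.
- by exists N => z /sN; exists s.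
- exact: sat_sat.
- by move=> n; apply: ideal_sat => //; apply: ideal_addid.
- by move=> n; apply: sat_sat.
- by move=> n; apply: satS; apply: addidS.
- by move=> n; apply: satS; apply: addidS.
(* Nakayama at P: an element of [S n] is locally b + r x with b in [S n.+1], and r is in [S n]
   because x is outside Q. *)
have [t Pt SS] : exists2 t, ~ P t & forall a, S n a -> S n.+1 (t * a).
  apply: nakayama => // a Sa.
  have [|t Pt [b [_ [Sb [r ->] E]]]] := Sn a.
    by apply: sub_sat => //; apply: addidl.
  exists t => //; exists b, (r * x); split=> //.
  have Srx : S n (r * x).
    have -> : r * x = t * a - b by rewrite E addrC addKr.
    by apply: ideal_sub => //; [apply: ideal_mull|apply: decS].
  have Sr : S n r.
    have [u Qu Yu] := Srx; exists (u * x); first exact: prime_notM.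
    by rewrite -mulrA [x * r]mulrC.
  by rewrite mulrC; apply: sub_ideal_gen; exists x, r.
(* Nakayama at Q: Q^n lies locally in Q0 + Q Q^n, hence in Q0, which forces Q into Q0. *)
have [u Qu uQ] : exists2 u, ~ Q u & forall a, ipow Q n a -> Q0 (u * a).
  apply: nakayama => //; first exact: ideal_ipow.
  move=> a Qa; have [|v Qv [b [c [Qb Qc E]]]] := SS a.
    by apply: sub_sat => //; apply: addidr.
  exists (v * t); first by apply: prime_notM => // /QP.
  by exists b, c; split; rewrite -?mulrA.
apply: nQQ0; apply: (ipow_prime (n := n)) => // z /uQ /(primeM pQ0) [/Q0Q|//].
by move/Qu.
Qed.

(** With Q' maximal among the primes strictly below P, the prime P is minimal over Q' + (f) for
    every f in P outside Q'. *)
Lemma minimal_prime_between Q P : prime_ideal Q -> prime_ideal P -> Q `<` P ->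
  exists Q', [/\ prime_ideal Q', Q `<=` Q', Q' `<` P &
    forall P', prime_ideal P' -> Q' `<` P' -> P' `<=` P -> P `<=` P'].
Proof.
move=> pQ pP QP; have := QP; have := pQ; have := prime_ideal_ideal pQ.
move: Q {pQ QP}; apply: (noetherian_ind R_noeth) => Q idQ IH pQ QP.
have [H|/existsNP [P' /not_implyP [pP' /not_implyP [QP' /not_implyP [P'P nP']]]]] :=
  pselect (forall P', prime_ideal P' -> Q `<` P' -> P' `<=` P -> P `<=` P').
  by exists Q; split.
have [|Q' [? ? ? ?]] := IH P' (prime_ideal_ideal pP') QP' pP'; first by [].
by exists Q'; split=> //; apply: subset_trans QP'.1 _.
Qed.

(** Induction on the number of generators. Take Q next below P and a generator f outside Q. Since P
    is locally nilpotent modulo Q + (f), each other generator g has s g^N = q(g) + r f with q(g) in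
    Q. By [krull_pit], Q is minimal over the q(g), of which there is one fewer. *)
Lemma krull_height (fs : seq R) P n (c : nat -> set R) :
  minimal_over P [set` fs] -> prime_chain n c -> c n = P -> (n <= size fs)%N.
Proof.
have [k] := ubnP (size fs); elim: k => // k IHk in fs P n c *.
rewrite ltnS => fsk mP [pc ltc] cP; have [pP fP Pmin] := mP.
case: n => // n in pc ltc cP *.
have [Q [pQ cQ QP Qmax]] : exists Q', [/\ prime_ideal Q', c n `<=` Q', Q' `<` P &
    forall P', prime_ideal P' -> Q' `<` P' -> P' `<=` P -> P `<=` P'].
  by apply: minimal_prime_between => //; [apply: pc|rewrite -cP; apply: ltc].
have idQ := prime_ideal_ideal pQ; have idP := prime_ideal_ideal pP.
have [f ffs Qf] : exists2 f, f \in fs & ~ Q f.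
  apply: contrapT => H; case: QP => QP; apply; apply: Pmin => //.
  by move=> f ffs; apply: contrapT => Qf; apply: H; exists f.
have mPQ : minimal_over P (addid Q (princ f)).
  split=> //; first by apply: addid_sub => //; [case: QP|apply: princ_sub => //; apply: fP].
  move=> P' pP' QP' P'P; apply: Qmax => //; split.
    by apply: subset_trans QP'; exact: addidl (ideal_princ f).
  by move=> H; apply: Qf; apply: H; apply: QP'; apply: addidr => //; apply: princ_id.
have [N [s [Ps sN]]] := minimal_over_ipow (ideal_addid idQ (ideal_princ f)) mPQ.
have /choice [q qP] (g : R) : exists q, P g -> Q q /\ exists r, s * g ^+ N = q + r * f.
  have [Pg|Pg] := pselect (P g); last by exists 0.
  have [q [_ [Qq [r ->] E]]] := sN _ (ipowX N Pg).
  by exists q => _; split=> //; exists r.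
pose gs := rem f fs.
have sizegs : size fs = (size gs).+1 by rewrite size_rem // prednK //; case: (fs) ffs.
have gsP g : g \in gs -> P g by move=> /mem_rem /fP.
rewrite sizegs ltnS -(size_map q).
have mQ : minimal_over Q [set` map q gs].
  split=> //; first by move=> _ /= /mapP [g /gsP /qP [Qq _] ->].
  move=> Q' pQ' qQ' Q'Q; apply: contrapT => nQQ'.
  apply: (@krull_pit Q' Q P f) => //; split=> //.
    apply: addid_sub => //; first by apply: subset_trans Q'Q _; case: QP.
    by apply: princ_sub => //; apply: fP.
  move=> P' pP' QP' P'P; apply: Pmin => // g gfs.
  have idQ' := prime_ideal_ideal pQ'; have idP' := prime_ideal_ideal pP'.
  have P'f : P' f by apply: QP'; apply: addidr => //; apply: princ_id.
  have [-> //|gf] := eqVneq g f.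
  have ggs : g \in gs.
    have := perm_to_rem ffs => /perm_mem /(_ g).
    by rewrite inE (negPf gf) /= => <-.
  have [Qq [r E]] := qP g (gsP _ ggs).
  have : P' (s * g ^+ N).
    rewrite E; apply: ideal_add => //; last exact: ideal_mull.
    by apply: QP'; apply: addidl (ideal_princ f) _ _; apply: qQ'; apply: map_f.
  by case/(primeM pP') => [/P'P/Ps//|/(primeX pP')].
apply: (IHk (map q gs) Q n (fun i => if i == n then Q else c i)) => //.
- by rewrite size_map -ltnS -sizegs.
- split=> i iN; first by case: eqP => // _; apply: pc; apply: leqW.
  rewrite ltn_eqF //; have ci := ltc i (ltnW iN : (i < n.+1)%N).
  case: eqP => [iE|//]; rewrite iE in ci; split; first exact: subset_trans ci.1 cQ.
  by move=> H; case: ci => _; apply; apply: subset_trans H.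
- by rewrite eqxx.
Qed.

End LocalAlgebra.

(** * Hilbert's basis theorem *)

Section HilbertBasis.
Variables (R : comNzRingType) (R_noeth : noetherian R).
Implicit Types (J K : set {poly R}) (p q : {poly R}).

Definition lcoef J (n : nat) : set R :=
  [set c | exists2 q, J q & (size q <= n.+1)%N /\ q`_n = c].

Lemma ideal_lcoef J n : ideal J -> ideal (lcoef J n).
Proof.
move=> idJ; apply: ideal_intro => [|_ _ [p Jp [sp <-]] [q Jq [sq <-]]|a _ [p Jp [sp <-]]].
- by exists 0; [apply: ideal_zero|rewrite size_poly0 coef0].
- exists (p + q); first exact: ideal_add.
  by rewrite coefD (leq_trans (size_polyD _ _)) // geq_max sp.
- exists (a%:P * p); first exact: ideal_mull.
  by rewrite coefCM mul_polyC (leq_trans (size_scale_leq _ _)).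
Qed.

Lemma lcoefS J K n : J `<=` K -> lcoef J n `<=` lcoef K n.
Proof. by move=> JK c [q /JK]; exists q. Qed.

Lemma lcoef_le J i j : ideal J -> (i <= j)%N -> lcoef J i `<=` lcoef J j.
Proof.
move=> idJ ij; rewrite -(subnK ij); elim: (j - i)%N => [//|k IHk] c /IHk.
case=> q Jq [sq <-]; exists ('X * q); first exact: ideal_mull.
rewrite mulrC addSn coefMX /=; split=> //.
have [->|q0] := eqVneq q 0; first by rewrite mul0r size_poly0.
by rewrite size_mulX.
Qed.

Lemma lcoef_sub J K : ideal J -> ideal K -> K `<=` J ->
  (forall n, lcoef J n `<=` lcoef K n) -> J `<=` K.
Proof.
move=> idJ idK KJ JK p; have [n] := ubnP (size p); elim: n p => // n IHn p.
rewrite ltnS leq_eqVlt => /orP [/eqP sp|]; last exact: IHn.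
case: n sp IHn => [|n] sp IHn Jp.
  by move/eqP: sp; rewrite size_poly_eq0 => /eqP ->; apply: ideal_zero.
have [|q Kq [sq qn]] := JK n p`_n; first by exists p => //; rewrite sp.
rewrite -[p](subrK q); apply: ideal_add => //; apply: IHn; last first.
  by apply: ideal_sub => //; apply: KJ.
rewrite ltnS; apply/leq_sizeP => j; rewrite leq_eqVlt => /orP [/eqP <-|nj].
  by rewrite coefB qn subrr.
by rewrite coefB !nth_default ?subrr // (leq_trans _ nj) // sp.
Qed.

(** The ideals [lcoef J n] increase with n and their union is finitely generated, hence equal to
    some [lcoef J N]. Lifts of generators of [lcoef J n] for n <= N then generate J. *)
Theorem hilbert_basis : noetherian {poly R}.
Proof.
move=> J idJ.
have /choice [ps psP] n : exists ps : seq {poly R}, [set` ps] `<=` J /\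
    lcoef J n `<=` lcoef (ideal_gen [set` ps]) n.
  have [s Ls] := R_noeth (ideal_lcoef n idJ).
  have : [set` s] `<=` lcoef J n by rewrite Ls; apply: sub_ideal_gen.
  move=> sL; suff [ps [psJ sps]] : exists ps : seq {poly R}, [set` ps] `<=` J /\
      [set` s] `<=` lcoef (ideal_gen [set` ps]) n.
    exists ps; split=> //; rewrite Ls; apply: ideal_gen_sub => //.
    by apply: ideal_lcoef; apply: ideal_ideal_gen.
  elim: s {Ls} sL => [|c s IHs] sL; first by exists [::].
  have [x xs|ps [psJ sps]] := IHs; first by apply: sL; rewrite /= inE; apply/orP; right.
  have [q Jq qn] : lcoef J n c by apply: sL; rewrite /= mem_head.
  exists (q :: ps); split=> x; rewrite /= inE => /orP [/eqP ->|xs] //.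
  - exact: psJ.
  - by exists q => //; apply: sub_ideal_gen; rewrite /= mem_head.
  - apply: lcoefS (sps x xs); apply: ideal_gen_sub; first exact: ideal_ideal_gen.
    by move=> y yps; apply: sub_ideal_gen; rewrite /= inE; apply/orP; right.
pose L : set R := [set c | exists n, lcoef J n c].
have idL : ideal L.
  apply: ideal_intro => [|x y [i xi] [j yj]|a x [i xi]].
  - by exists 0%N; apply: ideal_zero; apply: ideal_lcoef.
  - exists (maxn i j); apply: ideal_add; first exact: ideal_lcoef.
      by apply: lcoef_le xi => //; apply: leq_maxl.
    by apply: lcoef_le yj => //; apply: leq_maxr.
  - by exists i; apply: ideal_mull => //; apply: ideal_lcoef.
have [s Ls] := R_noeth idL.
have [N sN] : exists N, [set` s] `<=` lcoef J N.
  have : [set` s] `<=` L by rewrite Ls; apply: sub_ideal_gen.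
  elim: s {Ls} => [|x s IHs] sL; first by exists 0%N.
  have [i xi] : L x by apply: sL; rewrite /= mem_head.
  have [|j sj] := IHs; first by move=> y ys; apply: sL; rewrite /= inE; apply/orP; right.
  exists (maxn i j) => y; rewrite /= inE => /orP [/eqP ->|ys].
    by apply: lcoef_le xi => //; apply: leq_maxl.
  by apply: (lcoef_le (j := maxn i j) idJ (leq_maxr _ _)); apply: sj.
exists (flatten [seq ps n | n <- iota 0 N.+1]); set t := flatten _.
have tJ : ideal_gen [set` t] `<=` J.
  apply: ideal_gen_sub => // x /= /flattenP [_ /mapP [n _ ->]].
  exact: (psP n).1.
apply/seteqP; split=> //; have idt := ideal_ideal_gen [set` t].
have JtN n : (n <= N)%N -> lcoef J n `<=` lcoef (ideal_gen [set` t]) n.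
  move=> nN; apply: subset_trans (psP n).2 _; apply: lcoefS.
  apply: ideal_gen_sub => // x xn; apply: sub_ideal_gen; apply/flattenP.
  by exists (ps n) => //; apply: map_f; rewrite mem_iota /= add0n ltnS.
apply: lcoef_sub => // n; have [/JtN //|Nn] := leqP n N.
have JL : lcoef J n `<=` L by move=> c Jc; exists n.
apply: (subset_trans JL); apply: (@subset_trans _ (lcoef J N)).
  by rewrite Ls; apply: ideal_gen_sub => //; apply: ideal_lcoef.
by apply: (subset_trans (JtN _ _)) => //; apply: lcoef_le => //; apply: ltnW.
Qed.

End HilbertBasis.

(** B is an iterated polynomial ring with one variable for each entry of s. The last clause is an
    induction principle for the image of [phi], the subring generated by s and the image of g. *)
Lemma noetherian_cover (R C : comNzRingType) (g : {rmorphism R -> C}) (s : seq C) :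
  noetherian R -> exists (B : comNzRingType) (phi : {rmorphism B -> C}),
  [/\ noetherian B, range g `<=` range phi, [set` s] `<=` range phi &
    forall S : set C, (forall x y, S x -> S y -> S (x + y)) ->
      (forall x y, S x -> S y -> S (x * y)) -> range g `<=` S -> [set` s] `<=` S ->
      range phi `<=` S].
Proof.
move=> R_noeth; elim: s => [|c s [B [phi [B_noeth gphi sphi minphi]]]].
  by exists R, g; split=> // x.
have cfc : commr_rmorph phi c by move=> x; apply: mulrC.
have phiP x : range phi x -> range (horner_morph cfc) x.
  by case=> y _ <-; exists y%:P => //; rewrite horner_morphC.
exists {poly B}, (horner_morph cfc); split.
- exact: hilbert_basis.
- by move=> x /gphi /phiP.
- move=> x; rewrite /= inE => /orP [/eqP ->|/sphi /phiP //].
  by exists 'X => //; rewrite horner_morphX.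
- move=> S SD SM gS sS _ [p _ <-]; have phiS : range phi `<=` S.
    by apply: minphi => // x xs; apply: sS; rewrite /= inE; apply/orP; right.
  elim/poly_ind: p => [|p b Sp].
    by rewrite rmorph0; apply: phiS; exists 0 => //; rewrite rmorph0.
  rewrite rmorphD rmorphM /= horner_morphX horner_morphC; apply: SD.
    by apply: SM => //; apply: sS; rewrite /= mem_head.
  by apply: phiS; exists b.
Qed.

(** * Homogeneous ideals of the Rees algebra *)

Section LocalRing.
Variables (A : comPzRingType) (m : set A).
Hypotheses (A_noeth : noetherian A) (A_local : local_ring m).

Lemma local_ideal : ideal m.
Proof. by case: A_local => -[]. Qed.

Lemma local_notin1 : ~ m 1.
Proof. by case: A_local => -[]. Qed.

(** Noetherian induction enlarges a proper ideal until it is maximal, hence equal to m. *)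
Lemma local_sub J : ideal J -> ~ J 1 -> J `<=` m.
Proof.
move: J; apply: (noetherian_ind A_noeth) => J idJ IH J1.
have [maxJ|nmaxJ] := pselect (maximal_ideal J); first by rewrite (A_local.2 J maxJ).
have [K [idK JK K1 KJ]] : exists K, [/\ ideal K, J `<=` K, ~ K 1 & K <> J].
  apply: contrapT => H; apply: nmaxJ; split=> // K idK JK K1.
  by apply: contrapT => KJ; apply: H; exists K.
apply: (subset_trans JK); apply: IH => //; split=> // KJ'.
by apply: KJ; apply/seteqP.
Qed.

Lemma local_unit x : ~ m x -> exists y, y * x = 1.
Proof.
move=> mx; apply: contrapT => H; apply: mx.
apply: (local_sub (ideal_princ x)); last exact: princ_id.
by case=> y E; apply: H; exists y.
Qed.

Lemma local_prime : prime_ideal m.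
Proof.
split; [exact: local_ideal|exact: local_notin1|move=> x y mxy].
apply: contrapT => /not_orP [/local_unit [x' x'x] /local_unit [y' y'y]].
apply: local_notin1; rewrite -[1]mulr1 -{1}x'x -y'y mulrACA.
by apply: ideal_mull => //; exact: local_ideal.
Qed.

End LocalRing.

(** Zorn's lemma for reverse inclusion: the intersection of a chain of primes is prime. *)
Lemma minimal_over_exists (A : comNzRingType) (P X : set A) :
  prime_ideal P -> X `<=` P -> exists2 Q, minimal_over Q X & Q `<=` P.
Proof.
move=> pP XP; pose T := {Q : set A | [/\ prime_ideal Q, X `<=` Q & Q `<=` P]}.
pose le : rel T := fun Q Q' => `[< sval Q' `<=` sval Q >].
have [||||[Q [pQ XQ QP]] Qmin] := @Zorn T le.
- by move=> Q; apply/asboolP.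
- by move=> Q Q' Q'' /asboolP h /asboolP h'; apply/asboolP => x /h' /h.
- move=> [Q hQ] [Q' hQ'] /asboolP h /asboolP h'; apply: eq_exist.
  exact/seteqP.
- move=> F totF; have [[Q0 FQ0]|F0] := pselect (exists Q, F Q); last first.
    exists (exist _ P (And3 pP XP (@subset_refl _ P))) => Q FQ; case: F0.
    by exists Q.
  pose U := \bigcap_(Q in F) sval Q.
  have pF Q : F Q -> prime_ideal (sval Q) by move=> _; case: (svalP Q).
  have iF Q (FQ : F Q) := prime_ideal_ideal (pF Q FQ).
  have pU : prime_ideal U.
    split.
    - apply: ideal_intro => [Q /iF /ideal_zero //|x y Ux Uy Q FQ|a x Ux Q FQ].
        by apply: ideal_add; [apply: iF|apply: Ux|apply: Uy].
      by apply: ideal_mull; [apply: iF|apply: Ux].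
    - by move=> /(_ _ FQ0); apply: prime1; apply: pF.
    move=> x y Uxy; apply: contrapT => /not_orP [].
    move=> /existsNP [Q1 /not_implyP [F1 Q1x]] /existsNP [Q2 /not_implyP [F2 Q2y]].
    have [/asboolP Q21|/asboolP Q12] := totF _ _ F1 F2.
      by have [/Q21|] := primeM (pF _ F2) (Uxy _ F2).
    by have [|/Q12] := primeM (pF _ F1) (Uxy _ F1).
  have XU : X `<=` U by move=> x Xx Q _; case: (svalP Q) => _ /(_ x Xx).
  have UP : U `<=` P by move=> x /(_ _ FQ0); case: (svalP Q0) => _ _; apply.
  by exists (exist _ U (And3 pU XU UP)) => Q FQ; apply/asboolP => x /(_ _ FQ).
exists Q => //; split=> // P' pP' XP' P'Q.
have := Qmin (exist _ P' (And3 pP' XP' (subset_trans P'Q QP))) (asboolT P'Q).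
by move=> /(congr1 (@sval _ _)) /= ->.
Qed.

(* A homogeneous ideal of the Rees algebra R[It] is the sequence K of its
   components: it consists of the polynomials with n-th coefficient in K n. *)
Section GradedIdeals.
Variables (R : comNzRingType) (R_noeth : noetherian R) (I : set R) (idI : ideal I).
Implicit Types (K Q T : nat -> set R) (S : nat -> set R).

Definition graded_ideal K :=
  [/\ forall n, ideal (K n), forall n, K n `<=` ipow I n &
      forall i j a x, ipow I i a -> K j x -> K (i + j)%N (a * x)].

(** Primality is tested on homogeneous elements only; [reesext_prime] extends it to all of R[It]. *)
Definition graded_prime Q :=
  [/\ graded_ideal Q, ~ Q 0%N 1 & forall i j x y, ipow I i x -> ipow I j y ->
      Q (i + j)%N (x * y) -> Q i x \/ Q j y].

Definition graded_sub K K' := forall n, K n `<=` K' n.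

(** This is R[It] as a subset of R[t]. *)
Definition reescoef : set {poly R} := [set p | forall n, ipow I n p`_n].

Definition reesext K : set {poly R} := [set p | forall n, K n p`_n].

Lemma reescoefC r : reescoef r%:P.
Proof. by move=> n; rewrite coefC; case: n => //= n; apply: (ideal_zero (ideal_ipow I n.+1)). Qed.

Lemma reescoefZX c : I c -> reescoef (c%:P * 'X).
Proof.
move=> Ic n; rewrite coefCM coefX; have [->|_] := eqVneq n 1%N.
  by rewrite mulr1 ipow1.
by rewrite mulr0; apply: ideal_zero; apply: ideal_ipow.
Qed.

Lemma reescoefD p q : reescoef p -> reescoef q -> reescoef (p + q).
Proof. by move=> hp hq n; rewrite coefD; apply: ideal_add => //; apply: ideal_ipow. Qed.

Lemma reescoefM p q : reescoef p -> reescoef q -> reescoef (p * q).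
Proof.
move=> hp hq n; rewrite coefM; apply: ideal_bigsum; first exact: ideal_ipow.
by move=> i _; rewrite -[n in ipow I n](subnKC (ltn_ord i : (i <= n)%N)); apply: ipowM.
Qed.

Lemma reesextM K p q : graded_ideal K -> reescoef p -> reesext K q -> reesext K (p * q).
Proof.
move=> [idK _ KM] hp hq n; rewrite coefM; apply: ideal_bigsum => // i _.
by rewrite -[n in K n](subnKC (ltn_ord i : (i <= n)%N)); apply: (KM _ _ _ _).
Qed.

(* Compare the lowest coefficients of p and q outside Q. *)
Lemma reesext_prime Q p q : graded_prime Q -> reescoef p -> reescoef q ->
  reesext Q (p * q) -> reesext Q p \/ reesext Q q.
Proof.
move=> [[idQ QI QM] Q1 Qp] hp hq Qpq; apply: contrapT => /not_orP [].
have lowest r : ~ reesext Q r -> exists n, ~ Q n r`_n /\ forall i, (i < n)%N -> Q i r`_i.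
  move=> /existsNP [n Qn]; have [k] := ubnP n; elim: k => // k IHk in n Qn *.
  rewrite ltnS => nk; have [H|] := pselect (forall i, (i < n)%N -> Q i r`_i).
    by exists n.
  by move=> /existsNP [i /not_implyP [ni Qi]]; apply: (IHk i Qi); apply: leq_trans nk.
move=> /lowest [a [Qa lta]] /lowest [b [Qb ltb]].
suff : Q (a + b)%N (p`_a * q`_b) by case/(Qp _ _ _ _ (hp a) (hq b)).
have ab : (a < (a + b).+1)%N by rewrite ltnS leq_addr.
have -> : p`_a * q`_b = (p * q)`_(a + b) -
    \sum_(i < (a + b).+1 | i != Ordinal ab) p`_i * q`_(a + b - i).
  by rewrite coefM (bigD1 (Ordinal ab)) //= addKn addrK.
apply: ideal_sub => //; apply: ideal_bigsum => // i ia.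
have ile : (i <= a + b)%N by rewrite -ltnS.
rewrite -[X in Q X](subnKC ile).
have [ltia|] := ltnP i a; last rewrite leq_eqVlt => /orP [/eqP ai|ltai].
- by rewrite addnC mulrC; apply: QM => //; apply: lta.
- by move/eqP: ia; case; apply/val_inj.
- by apply: QM => //; apply: ltb; rewrite ltn_subLR // ltn_add2r.
Qed.

(* S is meant to be a family of homogeneous elements: S n lies in I^n. *)
Definition graded_gen S n := ideal_gen [set z | exists i j b s,
  [/\ n = (i + j)%N, ipow I i b, S j s & z = b * s]].

Lemma sub_graded_gen S : graded_sub S (graded_gen S).
Proof. by move=> n s Ss; apply: sub_ideal_gen; exists 0%N, n, 1, s; rewrite mul1r. Qed.

Lemma graded_gen_ideal S : graded_sub S (ipow I) -> graded_ideal (graded_gen S).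
Proof.
move=> SI; split=> [n|n|i j a x Ia]; first exact: ideal_ideal_gen.
  apply: ideal_gen_sub; first exact: ideal_ipow.
  by move=> _ [i [j [b [s [-> Ib /SI Is ->]]]]]; apply: ipowM.
apply: (ideal_gen_sub (ideal_transporter a (ideal_ideal_gen _))).
move=> _ [k [l [b [s [-> Ib Ss ->]]]]] /=; rewrite mulrA; apply: sub_ideal_gen.
by exists (i + k)%N, l, (a * b), s; split; rewrite ?addnA //; apply: ipowM.
Qed.

Lemma graded_gen_sub S K : graded_ideal K -> graded_sub S K -> graded_sub (graded_gen S) K.
Proof.
move=> [idK _ KM] SK n; apply: ideal_gen_sub => // _ [i [j [b [s [-> Ib /SK Ks ->]]]]].
exact: KM.
Qed.

Definition adjoin K i x := graded_gen (fun n => K n `|` [set z | n = i /\ z = x]).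

Lemma adjoin_sub K i x : graded_sub K (adjoin K i x).
Proof. by move=> n y Ky; apply: sub_graded_gen; left. Qed.

Lemma adjoin_id K i x : adjoin K i x i x.
Proof. by apply: sub_graded_gen; right. Qed.

Lemma adjoin_ideal K i x : graded_ideal K -> ipow I i x -> graded_ideal (adjoin K i x).
Proof.
by move=> [_ KI _] Ix; apply: graded_gen_ideal => n y [/KI //|[-> ->]].
Qed.

Lemma adjoinM K i j x y : graded_ideal K -> K (i + j)%N (x * y) ->
  ipow I i x -> ipow I j y ->
  forall n k u v, adjoin K i x n u -> adjoin K j y k v -> K (n + k)%N (u * v).
Proof.
move=> gK; have [idK KI KM] := gK => Kxy Ix Iy n k u v Ku Kv.
have [_ Iu _] := adjoin_ideal gK Ix; have {Iu} Iu := Iu _ _ Ku.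
rewrite mulrC.
apply: (ideal_gen_sub (ideal_transporter v (idK (n + k)%N)) _ Ku).
move=> _ [a [b [c [s [-> Ic Ss ->]]]]] /=; rewrite mulrC.
have [_ Iv _] := adjoin_ideal gK Iy; have {}Iv := Iv _ _ Kv.
rewrite -addnA -mulrA; apply: (KM _ _ _ _) => //.
case: Ss => [Ks|[-> ->]]; first by rewrite addnC mulrC; apply: (KM _ _ _ _).
apply: (ideal_gen_sub (ideal_transporter x (idK (i + k)%N)) _ Kv).
move=> _ [a' [b' [c' [s' [-> Ic' Ss' ->]]]]] /=.
rewrite mulrCA addnCA; apply: (KM _ _ _ _) => //.
by case: Ss' => [Ks|[-> ->]] //; apply: (KM _ _ _ _).
Qed.

Lemma range_cover (B : comPzRingType) (phi : {rmorphism B -> {poly R}}) n c :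
  (forall r, range phi r%:P) -> (forall a, I a -> range phi (a%:P * 'X)) ->
  ipow I n c -> range phi (c%:P * 'X^n).
Proof.
move=> phiC phiX; elim: n c => [|n IHn]; first by move=> c _; rewrite expr0 mulr1.
suff : ipow I n.+1 `<=` [set c | range phi (c%:P * 'X^(n.+1))] by [].
apply: ideal_gen_sub; last first.
  move=> _ [a [b [/phiX [x _ Ex] /IHn [y _ Ey] ->]]]; exists (x * y) => //.
  by rewrite rmorphM /= Ex Ey polyCM exprS mulrACA.
apply: ideal_intro => [|a b [x _ Ex] [y _ Ey]|r a [x _ Ex]].
- by exists 0; rewrite ?rmorph0 ?mul0r.
- by exists (x + y) => //; rewrite rmorphD polyCD mulrDl /= Ex Ey.
- by have [s _ Es] := phiC r; exists (s * x) => //; rewrite rmorphM /= Ex Es polyCM mulrA.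
Qed.

(* R[It] is a homomorphic image of a Noetherian polynomial ring over R. *)
Lemma graded_ind (Pr : (nat -> set R) -> Prop) :
  (forall K, graded_ideal K -> (forall K', graded_ideal K' -> graded_sub K K' ->
     ~ graded_sub K' K -> Pr K') -> Pr K) ->
  forall K, graded_ideal K -> Pr K.
Proof.
move=> IH; have [s Is] := R_noeth idI.
have sI : [set` s] `<=` I by rewrite Is; apply: sub_ideal_gen.
have [B [phi [B_noeth gphi sphi minphi]]] :=
  @noetherian_cover R {poly R} (polyC : {rmorphism R -> {poly R}})
    [seq c%:P * 'X | c <- s] R_noeth.
have phiC r : range phi r%:P by apply: gphi; exists r.
have phiX : I `<=` [set a | range phi (a%:P * 'X)].
  rewrite Is; apply: ideal_gen_sub; last first.
    by move=> a sa; apply: sphi; apply: map_f.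
  apply: ideal_intro => [|a b [x _ Ex] [y _ Ey]|r a [x _ Ex]].
  - by exists 0; rewrite ?rmorph0 ?mul0r.
  - by exists (x + y) => //; rewrite rmorphD polyCD mulrDl /= Ex Ey.
  - by have [t _ Et] := phiC r; exists (t * x) => //; rewrite rmorphM /= Ex Et polyCM mulrA.
have phiR x : reescoef (phi x).
  suff : range phi `<=` reescoef by apply; exists x.
  apply: minphi; [exact: reescoefD|exact: reescoefM| |].
    by move=> _ [r _ <-]; apply: reescoefC.
  by move=> _ /= /mapP [c /sI Ic ->]; apply: reescoefZX.
(* Contraction to the Noetherian ring B keeps inclusions strict, because every c t^n with c in I^n
   has a preimage in B. *)
pose mu K : set B := [set b | reesext K (phi b)].
have idmu K : graded_ideal K -> ideal (mu K).
  move=> gK; have [idK KI KM] := gK.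
  apply: ideal_intro => [n|x y Kx Ky n|a x Kx] /=.
  - by rewrite rmorph0 coef0; apply: ideal_zero.
  - by rewrite rmorphD coefD; apply: ideal_add.
  - by rewrite /mu /= rmorphM; apply: reesextM.
have H J : ideal J -> forall K, graded_ideal K -> mu K = J -> Pr K.
  move: J; apply: (noetherian_ind B_noeth) => J idJ IHJ K gK muK.
  apply: IH => // K' gK' KK' nKK'.
  apply: (IHJ (mu K')) => //; first exact: idmu.
  rewrite -muK; split; first by move=> b Kb n; apply: KK'.
  move=> muK'; apply: nKK' => n c K'c.
  have [idK' K'I _] := gK'.
  have [b _ Eb] := range_cover phiC phiX (K'I _ _ K'c).
  have : mu K b.
    apply: muK' => k; rewrite Eb coefCM coefXn; have [->|_] := eqVneq k n.
      by rewrite mulr1.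
    by rewrite mulr0; apply: ideal_zero.
  by move/(_ n); rewrite Eb coefCM coefXn eqxx mulr1.
by move=> K gK; apply: (H (mu K)) => //; apply: idmu.
Qed.

(** If x y is in K with x, y homogeneous outside K, the lists for K + (x) and K + (y) are
    concatenated, and the product of these two ideals lies in K. The last clause is what remains of
    the fact that K contains a product of primes over it. *)
Lemma graded_primes_over K : graded_ideal K -> exists L : seq (nat -> set R),
  [/\ forall T, T \in L -> graded_prime T /\ graded_sub K T,
      forall Q, graded_prime Q -> graded_sub K Q -> exists2 T, T \in L & graded_sub T Q &
      (forall T, T \in L -> I `<=` T 1%N) -> exists N, ipow I N `<=` K N].
Proof.
move: K; apply: graded_ind => K gK IH; have [idK KI KM] := gK.
have [K1|K1] := pselect (K 0%N 1).
  exists [::]; split=> // [Q [_ Q1 _] KQ|_]; first by case: Q1; apply: KQ.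
  by exists 0%N => x _; apply: ideal_one.
have [pK|npK] := pselect (graded_prime K).
  exists [:: K]; split=> [T|Q _ KQ|HI]; first by rewrite inE => /eqP ->; split=> // n.
    by exists K; rewrite ?mem_head.
  by exists 1%N; rewrite ipow1 //; apply: HI; rewrite mem_head.
have [i [j [x [y [Ix Iy Kxy Kx Ky]]]]] : exists i j x y,
    [/\ ipow I i x, ipow I j y, K (i + j)%N (x * y), ~ K i x & ~ K j y].
  apply: contrapT => H; apply: npK; split=> // i j x y Ix Iy Kxy.
  by apply: contrapT => /not_orP [Kx Ky]; apply: H; exists i, j, x, y.
have [||L1 [L1p L1c L1I]] := IH _ (adjoin_ideal gK Ix); first exact: adjoin_sub.
  by move=> H; apply: Kx; apply: H; apply: adjoin_id.
have [||L2 [L2p L2c L2I]] := IH _ (adjoin_ideal gK Iy); first exact: adjoin_sub.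
  by move=> H; apply: Ky; apply: H; apply: adjoin_id.
exists (L1 ++ L2); split=> [T|Q pQ KQ|HI].
- by rewrite mem_cat => /orP [/L1p|/L2p] [pT KT]; split=> // n z /adjoin_sub /KT.
- have [gQ _ Qp] := pQ.
  have [Qx|Qy] := Qp _ _ _ _ Ix Iy (KQ _ _ Kxy).
    have [|T TL TQ] := L1c Q pQ; last by exists T; rewrite // mem_cat TL.
    by apply: graded_gen_sub => // n z [/KQ //|[-> ->]].
  have [|T TL TQ] := L2c Q pQ; last by exists T; rewrite // mem_cat TL orbT.
  by apply: graded_gen_sub => // n z [/KQ //|[-> ->]].
- have [|N1 H1] := L1I; first by move=> T TL; apply: HI; rewrite mem_cat TL.
  have [|N2 H2] := L2I; first by move=> T TL; apply: HI; rewrite mem_cat TL orbT.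
  exists (N1 + N2)%N; apply: ipowD_sub => // u v /H1 Hu /H2 Hv.
  exact: (adjoinM gK Kxy Ix Iy Hu Hv).
Qed.

Lemma ipow_exp d e f : ipow I d f -> ipow I (d * e)%N (f ^+ e).
Proof. by move=> If; elim: e => [|e IHe]; rewrite ?muln0 // mulnS exprS; apply: ipowM. Qed.

Lemma graded_ideal_exp K d e f : graded_ideal K -> K d f -> (0 < e)%N ->
  K (d * e)%N (f ^+ e).
Proof.
move=> [_ KI KM] Kf; case: e => // e _; rewrite mulnS exprS addnC mulrC.
by apply: (KM _ _ _ _) => //; apply: ipow_exp; apply: KI.
Qed.

Lemma graded_prime_exp T d e f : graded_prime T -> ipow I d f ->
  T (d * e)%N (f ^+ e) -> T d f.
Proof.
move=> [_ T1 Tp] If; elim: e => [|e IHe]; first by rewrite muln0.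
by rewrite mulnS exprS => /Tp -[//|//||//]; [exact: ipow_exp|].
Qed.

(** Homogeneous prime avoidance. Elements to be added must have equal degree, so powers are taken;
    the element of It outside each prime keeps the degrees positive. *)
Lemma graded_avoidance (L : seq (nat -> set R)) :
  (forall T, T \in L -> graded_prime T /\ exists2 a, I a & ~ T 1%N a) ->
  exists d f, [/\ (0 < d)%N, ipow I d f & forall T, T \in L -> ~ T d f].
Proof.
have [k] := ubnP (size L); elim: k => // k IHk in L *; case: L => [|T L] /=.
  by exists 1%N, 0; split=> //; apply: ideal_zero; apply: ideal_ipow.
rewrite ltnS => Lk LP.
have LPL T' : T' \in L -> graded_prime T' /\ exists2 a, I a & ~ T' 1%N a.
  by move=> T'L; apply: LP; rewrite inE T'L orbT.
have [d [f [d0 If fL]]] := IHk L Lk LPL.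
have [Tf|Tf] := pselect (T d f); last first.
  by exists d, f; split=> // T'; rewrite inE => /orP [/eqP ->|/fL].
(* If T' lies in T, avoiding T avoids T' too, so T can replace T' in the shorter list. *)
have [[T' T'L T'T]|H] := pselect (exists2 T', T' \in L & graded_sub T' T).
  have [||d' [f' [d'0 If' f'L]]] := IHk (T :: rem T' L).
  - by rewrite /= size_rem // prednK //; case: (L) T'L.
  - by move=> U; rewrite inE => /orP [/eqP ->|/mem_rem /LPL //]; apply: LP; rewrite mem_head.
  have Tf' : ~ T d' f' by apply: f'L; rewrite mem_head.
  exists d', f'; split=> // U; rewrite inE => /orP [/eqP -> //|UL].
  have [->|UT'] := eqVneq U T'; first by move=> /T'T.
  apply: f'L; rewrite inE; apply/orP; right.
  by have := perm_to_rem T'L => /perm_mem /(_ U); rewrite UL inE (negPf UT').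
have [gT' [a Ia Ta]] := LP T (mem_head _ _); have [gT T1 Tp] := gT'.
(* No T' lies in T, so g can be a product of elements of the T' outside T, started with a in degree
   1. *)
have [e [g [e0 Ig Tg gL]]] : exists e g,
    [/\ (0 < e)%N, ipow I e g, ~ T e g & forall T', T' \in L -> T' e g].
  elim: (L) H LPL => [|U M IHM] H HM; first by exists 1%N, a; rewrite ipow1.
  have [|T' T'M|e [g [e0 Ig Tg gM]]] := IHM.
  - by case=> T' T'M T'T; apply: H; exists T'; rewrite // inE T'M orbT.
  - by apply: HM; rewrite inE T'M orbT.
  have [n [x [Ux Tx]]] : exists n x, U n x /\ ~ T n x.
    apply: contrapT => H'; apply: H; exists U; rewrite ?mem_head // => n x Ux.
    by apply: contrapT => Tx; apply: H'; exists n, x.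
  have [[[_ UI UM] _ _] _] := HM U (mem_head _ _).
  exists (n + e)%N, (x * g); split; first by rewrite ltn_addl.
  - by apply: ipowM => //; apply: UI.
  - by move=> /Tp [||//|//] //; apply: UI.
  - move=> T'; rewrite inE => /orP [/eqP ->|T'M].
      by rewrite addnC mulrC; apply: UM.
    have [[[_ _ T'Mul] _ _] _] : graded_prime T' /\ exists2 a, I a & ~ T' 1%N a.
      by apply: HM; rewrite inE T'M orbT.
    by apply: T'Mul; [apply: UI|apply: gM].
(* Both powers have degree d e, and each prime of the list contains exactly one of the two. *)
exists (d * e)%N, (f ^+ e + g ^+ d); split; first by rewrite muln_gt0 d0.
  apply: ideal_add; first exact: ideal_ipow; first exact: ipow_exp.
  by rewrite mulnC; apply: ipow_exp.
move=> T'; rewrite inE => /orP [/eqP ->|T'L] Hfg.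
  apply: Tg; apply: (graded_prime_exp (e := d) gT' Ig); rewrite mulnC.
  have [idT _ _] := gT.
  rewrite -[g ^+ d](addKr (f ^+ e)) addrC; apply: ideal_sub => //.
  exact: graded_ideal_exp.
have [pT' _] := LPL T' T'L; have [[idT' T'I T'M] _ _] := pT'.
apply: (fL T' T'L); apply: (graded_prime_exp (e := e) pT' If).
rewrite -[f ^+ e](addrK (g ^+ d)); apply: ideal_sub => //.
by rewrite mulnC; apply: graded_ideal_exp => //; apply: gL.
Qed.

End GradedIdeals.

(** * Chains of homogeneous primes containing m *)

Section GradedChains.
Variables (R : comNzRingType) (m I : set R).
Hypotheses (R_noeth : noetherian R) (R_local : local_ring m).
Hypotheses (idI : ideal I) (Im : I `<=` m).

Definition graded_chain n (c : nat -> nat -> set R) :=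
  (forall i, (i <= n)%N -> graded_prime I (c i) /\ m `<=` c i 0%N) /\
  (forall i, (i < n)%N -> graded_sub (c i) (c i.+1) /\ ~ graded_sub (c i.+1) (c i)).

Definition irrelevant n : set R := if n is 0 then m else ipow I n.

Lemma irrelevant_prime : graded_prime I irrelevant.
Proof.
have pm := local_prime R_noeth R_local; have idm := prime_ideal_ideal pm.
split; first split.
- by case=> [|n]; [|apply: (ideal_ipow I n.+1)].
- by case=> [|n] x.
- move=> [|i] j a x Ia; last by case: j => [|j] Ix; apply: (@ipowM _ I i.+1).
  by case: j => [|j] Ix; [apply: ideal_mull|apply: (@ipowM _ I 0 j.+1)].
- exact: local_notin1.
- by move=> [|i] [|j] x y Ix Iy //; [apply: primeM|right|left|left].
Qed.

Lemma graded_chain_rcons n c Q : graded_chain n c -> graded_prime I Q -> m `<=` Q 0%N ->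
  graded_sub (c n) Q -> ~ graded_sub Q (c n) ->
  graded_chain n.+1 (fun i => if i == n.+1 then Q else c i).
Proof.
move=> [cp clt] pQ mQ cQ Qc; split=> i.
  by case: eqP => // /eqP; rewrite leq_eqVlt => /negPf -> /cp.
rewrite ltnS => iN; rewrite ltn_eqF ?ltnS //.
case: (eqVneq i n) => [->|iE]; first by rewrite eqxx.
rewrite eqSS (negPf iE); apply: clt.
by rewrite ltn_neqAle iE.
Qed.

(** Such a Q contains m in degree 0 and all of I^n in positive degree n, so it contains every proper
    homogeneous ideal. *)
Lemma graded_sub_irrelevant K Q : graded_ideal I K -> ~ K 0%N 1 ->
  graded_prime I Q -> m `<=` Q 0%N -> I `<=` Q 1%N -> graded_sub K Q.
Proof.
move=> [idK KI _] K1 [[idQ _ QM] _ _] mQ IQ [|n].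
  exact: subset_trans (local_sub R_noeth R_local (idK 0%N) K1) mQ.
apply: (subset_trans (KI n.+1)); apply: ideal_gen_sub => // _ [a [b [Ia Ib ->]]].
by rewrite mulrC -addn1; apply: (QM _ _ _ _) => //; apply: IQ.
Qed.

(** A pair (d, f) stands for the homogeneous element f t^d; m is added in degree 0. *)
Definition seq_gen (fs : seq (nat * R)) n : set R :=
  [set z | (n = 0%N /\ m z) \/ (n, z) \in fs].

(* If m and the f's generate I^N modulo m I^N, Nakayama shows that I lies in
   every prime minimal over the f's, which Krull's theorem makes too small. *)
Lemma few_generators (fs : seq (nat * R)) N :
  (forall p, p \in fs -> m p.2) -> ipow I N `<=` graded_gen I (seq_gen fs) N ->
  exists2 P, prime_ideal P /\ I `<=` P &
    forall n c, prime_chain n c -> c n = P -> (n <= size fs)%N.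
Proof.
move=> fsm IN; have pm := local_prime R_noeth R_local; have idm := prime_ideal_ideal pm.
pose gs := map snd fs.
have gsm : [set` gs] `<=` m by move=> _ /mapP [p pfs ->]; apply: fsm.
have idgs := ideal_ideal_gen [set` gs].
have [s ms sI] : exists2 s, ~ m s & forall a, ipow I N a -> ideal_gen [set` gs] (s * a).
  apply: nakayama => //; first exact: ideal_ipow.
  apply: (subset_trans IN); apply: subset_trans _ (sub_sat pm).
  have idp : ideal (prodid m (ipow I N)) := ideal_ideal_gen _.
  apply: ideal_gen_sub; first exact: ideal_addid.
  move=> _ [i [j [b [z [NE Ib Sz ->]]]]]; case: Sz => [[j0 mz]|zfs].
    apply: addidr => //; apply: sub_ideal_gen; exists z, b.
    by rewrite NE j0 addn0 mulrC.
  apply: (addidl idp); apply: (ideal_mull b idgs); apply: sub_ideal_gen.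
  by apply/mapP; exists (j, z).
have [P mP Pm] := minimal_over_exists pm gsm; have [pP gsP _] := mP.
exists P; last by move=> n c cc cP; rewrite -(size_map snd); apply: krull_height mP cc cP.
split=> //; apply: (ipow_prime (n := N) pP) => a /sI sa.
have /(primeM pP) [/Pm //|//] : P (s * a).
by move: sa; apply: ideal_gen_sub => //; apply: prime_ideal_ideal.
Qed.

(** Inductive step: a prime Q over the enlarged sequence contains a prime T of the list L over the
    old one. If T is among the avoided primes, the new element separates Q from T, and the chain
    ending in T extends by Q. *)
Lemma graded_chain_gens h :
  (forall P, prime_ideal P -> I `<=` P ->
     exists n c, [/\ (h <= n)%N, prime_chain n c & c n = P]) ->
  forall j, (j <= h)%N -> exists fs : seq (nat * R), [/\ size fs = j,
    forall p, p \in fs -> (0 < p.1)%N /\ ipow I p.1 p.2 &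
    forall Q, graded_prime I Q -> m `<=` Q 0%N -> (forall p, p \in fs -> Q p.1 p.2) ->
      exists2 c, graded_chain j c & c j = Q].
Proof.
move=> Hh; elim=> [_|j IHj jh].
  by exists [::]; split=> // Q pQ mQ _; exists (fun=> Q).
have [fs [sfs fsI Hfs]] := IHj (ltnW jh).
pose K := graded_gen I (seq_gen fs).
have gK : graded_ideal I K.
  by apply: graded_gen_ideal => n z [[-> _] //|/fsI []].
have KP T : graded_sub K T -> m `<=` T 0%N /\ forall p, p \in fs -> T p.1 p.2.
  move=> KT; split=> [z mz|[n z] pfs]; apply: KT; apply: sub_graded_gen.
    by left.
  by right.
have [L [LP Lcov LI]] := graded_primes_over R_noeth idI gK.
pose L' := [seq T <- L | `[< exists2 a, I a & ~ T 1%N a >]].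
(* Otherwise [few_generators] yields a prime over I all of whose chains have length at most j, while
   one of length at least h > j exists. *)
have [T0 T0L'] : exists T0, T0 \in L'.
  apply: contrapT => noL'; have [T TL a Ia|N IN] := LI.
    apply: contrapT => Ta; apply: noL'; exists T; rewrite mem_filter TL andbT.
    by apply/asboolP; exists a.
  have [|P [pP IP] Pht] := few_generators _ IN.
    by move=> p /fsI [p0 Ip]; apply: Im; apply: ipow_sub Ip.
  have [n [c [hn cc cP]]] := Hh P pP IP.
  by have := leq_trans hn (Pht _ _ cc cP); rewrite sfs leqNgt jh.
have L'P T : T \in L' -> graded_prime I T /\ exists2 a, I a & ~ T 1%N a.
  by rewrite mem_filter => /andP [/asboolP Ta /LP [pT _]].
have [d [f [d0 If L'f]]] := graded_avoidance idI L'P.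
exists ((d, f) :: fs); split=> [|p|Q pQ mQ fsQ]; first by rewrite /= sfs.
  by rewrite inE => /orP [/eqP ->|/fsI].
have ext T : T \in L' -> graded_sub T Q -> ~ graded_sub Q T ->
    exists2 c, graded_chain j.+1 c & c j.+1 = Q.
  rewrite mem_filter => /andP [_ /LP [pT KT]] TQ QT; have [mT fsT] := KP _ KT.
  have [c cc cT] := Hfs T pT mT fsT; rewrite -{}cT in TQ QT.
  exists (fun i => if i == j.+1 then Q else c i); last by rewrite eqxx.
  exact: graded_chain_rcons.
have Qf : Q d f by apply: (fsQ (d, f)); rewrite mem_head.
have [|T TL TQ] := Lcov Q pQ.
  apply: graded_gen_sub; first by case: pQ.
  move=> n z [[-> /mQ //]|zfs]; apply: (fsQ (n, z)).
  by rewrite inE zfs orbT.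
have [TL'|TL'] := boolP (T \in L').
  by apply: (ext T) => // QT; apply: (L'f T TL'); apply: QT.
(* Here T, and with it Q, contains m and It. So Q contains every proper homogeneous ideal, and [T0]
   serves in place of T since it misses part of It. *)
have IT : I `<=` T 1%N.
  move=> a Ia; apply: contrapT => Ta; move/negP: TL'; apply; rewrite mem_filter TL andbT.
  by apply/asboolP; exists a.
have [[gT0 T01 _] [a Ia T0a]] := L'P _ T0L'.
have IQ : I `<=` Q 1%N by apply: subset_trans IT (TQ _).
apply: (ext T0) => //; first exact: graded_sub_irrelevant.
by move=> QT0; apply: T0a; apply: QT0; apply: IQ.
Qed.

Theorem graded_chain_exists h :
  (forall P, prime_ideal P -> I `<=` P ->
     exists n c, [/\ (h <= n)%N, prime_chain n c & c n = P]) ->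
  exists c, graded_chain h c.
Proof.
move=> /graded_chain_gens /(_ h (leqnn h)) [fs [_ fsI Hfs]].
have [|||c cc _] := Hfs irrelevant; [exact: irrelevant_prime|by []| |by exists c].
by move=> [[|n] f] /fsI [].
Qed.

End GradedChains.

(** * Primes of the fiber cone *)

Section QuotientRing.
Variables (A B : comPzRingType) (X : set A) (f : {rmorphism A -> B}).
Hypothesis fX : forall x, X x -> f x = 0.

Lemma quotring_factor : exists g : {rmorphism quotring X -> B}, forall x, g (qrpi X x) = f x.
Proof.
pose g (z : quotring X) : B := f (repr z).
have gE x : g (qrpi X x) = f x.
  have idf : ideal [set x | f x = 0].
    apply: ideal_intro => [|a b fa fb|a b fb] /=; first exact: rmorph0.
      by rewrite rmorphD fa fb addr0.
    by rewrite rmorphM fb mulr0.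
  have /= := ideal_gen_sub idf fX (qrepr (X := (X : set A^o)) x).
  by rewrite rmorphB => /subr0_eq.
have gA : zmod_morphism g.
  by elim/qrpi_ind=> x; elim/qrpi_ind=> y; rewrite -rmorphB !gE rmorphB.
have gM : monoid_morphism g.
  split; first by rewrite -[1]/(qrpi X 1) gE rmorph1.
  by elim/qrpi_ind=> x; elim/qrpi_ind=> y; rewrite -rmorphM !gE rmorphM.
pose gMix := GRing.isZmodMorphism.Build _ _ g gA.
pose gMix' := GRing.isMonoidMorphism.Build _ _ g gM.
by exists (HB.pack_for {rmorphism quotring X -> B} g gMix gMix').
Qed.

End QuotientRing.

Section MonomialEvaluation.
Variables (K : choiceType) (S : comNzRingType) (v : K -> S).

Definition cmeval (m : cmonom K) : S := \prod_(k <- finsupp m) v k ^+ m k.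

Lemma cmevalEw (m : cmonom K) (d : {fset K}) : fsubset (finsupp m) d ->
  cmeval m = \prod_(k <- d) v k ^+ m k.
Proof.
move=> le; rewrite /cmeval (big_fset_incl _ le) // => k _.
by rewrite -cmE_eq0 => /eqP ->; rewrite expr0.
Qed.

Fact cmeval_mmorphism : mmorphism cmeval.
Proof.
split=> [m1 m2|]; last by rewrite /cmeval mdom1 big_seq_fset0.
rewrite (cmevalEw (fsubsetUl (finsupp m1) (finsupp m2))).
rewrite (cmevalEw (fsubsetUr (finsupp m1) (finsupp m2))).
rewrite /cmeval mdomD -big_split /=; apply: eq_bigr => k _.
by rewrite cmM exprD.
Qed.

HB.instance Definition _ := isMultiplicative.Build _ _ cmeval cmeval_mmorphism.

Lemma cmeval_ucm k : cmeval (ucm k) = v k.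
Proof. by rewrite /cmeval mdomU big_seq_fset1 cmUU expr1. Qed.

End MonomialEvaluation.

Section ReesEvaluation.
Variables (R S : comNzRingType) (M : lmodType R) (f : {rmorphism R -> S}) (v : M -> S).
Hypothesis v_lin : forall a x y, v (a *: x + y) = f a * v x + v y.

(** By [v_lin], evaluating X_x at v x kills [sym_rel]. The last clause bounds the image from above
    and later confines it to R[It]. *)
Lemma sym_eval : exists g : {rmorphism sym M -> S},
  [/\ forall r, g (sym_str M r) = f r, forall x, exists z, g z = v x &
    forall S0 : set S, (forall x y, S0 x -> S0 y -> S0 (x + y)) ->
      (forall x y, S0 x -> S0 y -> S0 (x * y)) -> (forall r, S0 (f r)) ->
      (forall x, S0 (v x)) -> forall z, S0 (g z)].
Proof.
have [ev [evX evZ evS0]] : exists ev : {rmorphism malg (cmonom M) R -> S},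
  [/\ forall x, ev (mgen R (ucm x)) = v x, forall a p, ev (a *: p) = f a * ev p &
    forall S0 : set S, (forall x y, S0 x -> S0 y -> S0 (x + y)) ->
      (forall x y, S0 x -> S0 y -> S0 (x * y)) -> (forall r, S0 (f r)) ->
      (forall x, S0 (v x)) -> forall p, S0 (ev p)].
  exists (mmap f (cmeval v)); split=> [x|a p|S0 S0D S0M S0f S0v p] /=.
  - rewrite mmapU cmeval_ucm -[RHS]mul1r; congr (_ * _).
    exact: (rmorph1 f).
  - exact: mmapZ.
  - rewrite mmapE; apply: (big_ind S0) => //; first by rewrite -(rmorph0 f).
    move=> k _; apply: (S0M _ _) => //; apply: (big_ind S0) => [|//|x _].
      by rewrite -(rmorph1 f).
    elim: (k x) => [|n IHn]; first by rewrite expr0 -(rmorph1 f).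
    by rewrite exprS; apply: S0M.
have evR p : @sym_rel R M p -> ev p = 0.
  move=> [a [x [y ->]]].
  transitivity (ev (mgen R (ucm (a *: x + y))) -
      (f a * ev (mgen R (ucm x)) + ev (mgen R (ucm y)))).
    by rewrite (raddfB ev) (raddfD ev); congr (_ - (_ + _)); apply: evZ.
  transitivity (v (a *: x + y) - (f a * v x + v y)); last by rewrite v_lin subrr.
  by congr (_ - (_ * _ + _)); apply: evX.
have [g gE] := quotring_factor evR.
exists g; split=> [r|x|S0 S0D S0M S0f S0v].
- have evC : ev (r *: 1) = f r.
    by rewrite evZ -[RHS]mulr1; congr (_ * _); exact: (rmorph1 ev).
  by rewrite [LHS]gE.
- by exists (qrpi (@sym_rel R M) (mgen R (ucm x))); rewrite gE.
- by elim/qrpi_ind=> p; rewrite gE; apply: evS0.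
Qed.

(** S is torsionfree over R through f, so the torsion of the symmetric algebra maps to 0. *)
Lemma rees_eval : (forall r s, GRing.lreg r -> f r * s = 0 -> s = 0) ->
  exists g : {rmorphism rees M -> S},
  [/\ forall r, g (rees_str M r) = f r, forall x, exists z, g z = v x &
    forall S0 : set S, (forall x y, S0 x -> S0 y -> S0 (x + y)) ->
      (forall x y, S0 x -> S0 y -> S0 (x * y)) -> (forall r, S0 (f r)) ->
      (forall x, S0 (v x)) -> forall z, S0 (g z)].
Proof.
move=> freg; have [g [gf gv gS]] := sym_eval.
have gT (z : sym M) : @torsion R (resmod (sym_str M)) z -> g z = 0.
  move=> [r rreg rz]; apply: (freg r) => //.
  by rewrite -gf -rmorphM -[_ * z]/(r *: (z : resmod (sym_str M))) rz rmorph0.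
have [h hE] := quotring_factor gT; exists h; split=> [r|x|S0 S0D S0M S0f S0v].
- by rewrite -gf -hE.
- by have [z <-] := gv x; exists (qrpi _ z).
- by elim/qrpi_ind=> z; rewrite hE; apply: gS.
Qed.

End ReesEvaluation.

(** * Primes of a tensor product with R/m *)

Section TensorQuotient.
Variables (R : comNzRingType) (A : comPzRingType) (f : {rmorphism R -> A}) (m : set R).

Local Notation T := (tensalg f (qrpi m)).
Let j (a : A) : T := tens (a : resmod f) (1 : resmod (qrpi m)).

(** R/m is a quotient of R, so its elements are scalars that move to the left factor. *)
Lemma tensalg_pure (t : T) : exists a, t = j a.
Proof.
elim/tensor_ind: t => [|x y t [a ->]]; first by exists 0; rewrite /j tens0l.
elim/qrpi_ind: y => r; exists (f r * x + a); rewrite /j.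
have E : tens x (qrpi m r : resmod (qrpi m)) = tens (r *: x) (1 : resmod (qrpi m)).
  by rewrite tensZl -tensZr resscaleE mulr1.
exact: etrans (congr1 (fun t => t + _) E) (esym (tensDl _ _ _)).
Qed.

(** T is A/mA, whose primes come from the primes of A containing mA. The induced map T -> A/P shows
    that P is recovered from its image. *)
Lemma tensalg_prime (P : set A) : prime_ideal P -> (forall r, m r -> P (f r)) ->
  prime_ideal [set t : T | exists2 a, P a & t = j a] /\
  forall a, (exists2 b, P b & j a = j b) -> P a.
Proof.
move=> pP mP; have idP := prime_ideal_ideal pP.
have jP a : (exists2 b, P b & j a = j b) -> P a.
  pose pi : {rmorphism R -> quotring P} := qrpi P \o f.
  have [|beta betaE] := @quotring_factor R (quotring P) m pi.
    move=> r mr; apply/qpiP; rewrite subr0.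
    by apply: sub_ideal_gen; apply: mP.
  pose h (x : resmod f) (y : resmod (qrpi m)) : resmod pi := qrpi P x * beta y.
  have hl y : linear (h^~ y).
    by move=> r x x'; rewrite /h rmorphD mulrDl rmorphM -mulrA.
  have hr x : linear (h x).
    by move=> r y y'; rewrite /h rmorphD mulrDr rmorphM betaE mulrCA.
  have hj b : tensor_lift h (j b) = qrpi P b.
    by rewrite (tensor_lift_tens hl hr) /h rmorph1 mulr1.
  move=> [b Pb /(congr1 (tensor_lift h))]; rewrite !hj => /qpiP.
  move/(ideal_gen_sub idP (@subset_refl _ P)) => Pab.
  by rewrite -[a](subrK b); apply: ideal_add.
have jM a b : j a * j b = j (a * b).
  by rewrite -[LHS]/(tmul _ _) tmulE mulr1.
split=> //; split.
- apply: ideal_intro => [|_ _ [a Pa ->] [b Pb ->]|t _ [a Pa ->]].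
  + by exists 0; [apply: ideal_zero|rewrite /j tens0l].
  + by exists (a + b); [apply: ideal_add|rewrite /j tensDl].
  + have [b ->] := tensalg_pure t; exists (b * a); first exact: ideal_mull.
    by rewrite jM.
- by move=> /(jP 1)/(prime1 pP).
- move=> s t; have [a ->] := tensalg_pure s; have [b ->] := tensalg_pure t.
  by rewrite jM => /jP /(primeM pP) [Pa|Pb]; [left; exists a|right; exists b].
Qed.

Lemma tensalg_prime_chain n (c : nat -> set A) : prime_chain n c ->
  (forall r, m r -> c 0%N (f r)) -> exists c', @prime_chain T n c'.
Proof.
move=> [pc clt] mc.
have c0 i : (i <= n)%N -> c 0%N `<=` c i.
  elim: i => [_ //|i IHi iN]; apply: (subset_trans (IHi (ltnW iN))).
  by case: (clt i iN).
have mci i : (i <= n)%N -> forall r, m r -> c i (f r).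
  by move=> iN r /mc; apply: c0.
exists (fun i => [set t : T | exists2 a, c i a & t = j a]); split=> i iN.
  by have [] := tensalg_prime (pc i iN) (mci i iN).
have [sub nsub] := clt i iN; split.
  by move=> _ [a ca ->]; exists a => //; apply: sub.
move=> H; apply: nsub => a ca.
have [_] := tensalg_prime (pc i (ltnW iN)) (mci i (ltnW iN)); apply.
by apply: H; exists a.
Qed.

End TensorQuotient.

Lemma ideal_range (R : comNzRingType) (M : lmodType R) (D : {linear M -> R^o}) :
  ideal (range D : set R).
Proof.
apply: ideal_intro => [|_ _ [x _ <-] [y _ <-]|a _ [x _ <-]].
- by exists 0; rewrite ?raddf0.
- by exists (x + y); rewrite ?raddfD.
- by exists (a *: x); rewrite ?linearZ.
Qed.

(** The map x -> D(x) t induces a surjection of the Rees algebra onto R[It], I = [range D], along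
    which the chain is contracted; preimages of the a t^k with a in I^k keep it strict. *)
Lemma rees_prime_chain (R : comNzRingType) (m : set R) (M : lmodType R)
    (D : {linear M -> R^o}) n c :
  graded_chain m (range D) n c ->
  exists2 c', @prime_chain (rees M) n c' & forall r, m r -> c' 0%N (rees_str M r).
Proof.
move=> [pc clt]; have idI := ideal_range D.
pose v (x : M) : {poly R} := (D x : R)%:P * 'X.
have [|r p rreg rp0|g [gC gv gR]] := @rees_eval R {poly R} M (polyC : {rmorphism R -> {poly R}}) v.
- by move=> a x y; rewrite /v linearP /= polyCD mulrDl polyCM mulrA.
- apply/polyP => i; apply: rreg; rewrite coef0 mulr0.
  by have := congr1 (fun q : {poly R} => q`_i) rp0; rewrite coefCM coef0.
have gI z : reescoef (range D) (g z).
  apply: gR; [exact: reescoefD|exact: reescoefM|exact: reescoefC|].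
  by move=> x; apply: reescoefZX => //; exists x.
have gcov k a : ipow (range D) k a -> range g (a%:P * 'X^k).
  apply: range_cover; first by move=> r; exists (rees_str M r) => //; apply: gC.
  by move=> _ [x _ <-]; have [z gz] := gv x; exists z.
exists (fun i => [set z | reesext (c i) (g z)]); last first.
  move=> r mr k /=; rewrite [g _]gC coefC; have [[[idc _ _] _ _] mc] := pc 0%N (leq0n n).
  by case: k => [|k] /=; [apply: mc|apply: ideal_zero].
split=> i iN.
  have [pci _] := pc i iN; have [gci ci1 _] := pci; have [idc _ _] := gci.
  split.
  - apply: ideal_intro => [k|x y cx cy k|a x cx] /=.
    + by rewrite rmorph0 coef0; apply: ideal_zero.
    + by rewrite rmorphD coefD; apply: ideal_add.
    + by rewrite rmorphM; apply: reesextM gci (gI a) cx.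
  - move=> H; apply: ci1; have : c i 0%N (g 1)`_0 := H 0%N.
    by rewrite rmorph1 coef1.
  - by move=> x y /=; rewrite rmorphM; apply: reesext_prime pci (gI x) (gI y).
have [sub nsub] := clt i iN; split; first by move=> z cz k; apply: sub.
move=> H; apply: nsub => k a ca.
have [[[idc' cI _] _ _] _] := pc i.+1 iN.
have [z _ gz] := gcov k a (cI _ _ ca).
have : reesext (c i) (g z).
  apply: H => l; rewrite gz coefCM coefXn; have [->|_] := eqVneq l k.
    by rewrite mulr1.
  by rewrite mulr0; apply: ideal_zero.
by move=> /(_ k); rewrite gz coefCM coefXn eqxx mulr1.
Qed.

(** * Minors and Fitting ideals *)

Section BarIntBounds.
Implicit Types (S : set (\bar int)) (x y : \bar int).

Lemma bounded_int_max (S : set int) (a b : int) : S a -> (forall i, S i -> i <= b) ->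
  exists2 k, S k & forall i, S i -> i <= k.
Proof.
move=> Sa Sb.
have absE i : S i -> b - (absz (b - i))%:Z = i.
  by move=> /Sb ib; rewrite gez0_abs ?subr_ge0 // opprB addrC subrK.
have ex : exists n, `[< S (b - n%:Z) >].
  by exists (absz (b - a)); rewrite absE //; apply/asboolP.
have [n /asboolP Sn nmin] := find_ex_minn ex.
exists (b - n%:Z) => // i Si; rewrite -(absE i Si) lerD2l lerN2 lez_nat.
by apply: nmin; rewrite absE //; apply/asboolP.
Qed.

(** On a nonempty set [supremum] is a choice from [supremums] with a default value; this makes it a
    true supremum. *)
Lemma supremums_neq0 S : supremums S !=set0.
Proof.
have [[b ubS]|noub] := pselect (exists b : int, ubound S b%:E%E); last first.
  exists +oo%E; split=> [x _|[k|_|]]; [exact: leey| |exact: leey|].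
    by move=> ubk; case: noub; exists k.
  by move=> ub; case: noub; exists 0 => x Sx; apply: le_trans (ub x Sx) (leNye _).
have [[a Sa]|noa] := pselect (exists a : int, S a%:E%E); last first.
  exists -oo%E; split=> [[k Sk|Sy|//]|x _]; last exact: leNye.
    by case: noa; exists k.
  by have := ubS _ Sy; rewrite leye_eq.
have [i Si|k Sk kmax] := @bounded_int_max [set i | S i%:E%E] a b Sa.
  by have := ubS _ Si; rewrite lee_fin.
exists k%:E%E; split=> [[i|Sy|_]|x /(_ _ Sk) //].
- by move=> /kmax; rewrite lee_fin.
- by have := ubS _ Sy; rewrite leye_eq.
- exact: leNye.
Qed.

Lemma infimums_neq0 S : infimums S !=set0.
Proof.
have [t [ubt lbt]] := supremums_neq0 (lbound S); exists t; split=> // x Sx.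
by apply: lbt => y; apply.
Qed.

Lemma le_supremum S x : S x -> (x <= supremum -oo S)%E.
Proof.
move=> Sx; rewrite /supremum; case: ifP => [/eqP S0|_]; first by rewrite S0 in Sx.
by have [+ _] := xgetPex -oo%E (supremums_neq0 S); apply.
Qed.

Lemma supremum_le S y : (forall x, S x -> (x <= y)%E) -> (supremum -oo S <= y)%E.
Proof.
move=> Sy; rewrite /supremum; case: ifP => _; first exact: leNye.
by have [_] := xgetPex -oo%E (supremums_neq0 S); apply.
Qed.

Lemma infimum_le S x : S x -> (infimum +oo S <= x)%E.
Proof.
move=> Sx; rewrite /infimum; case: ifP => [/eqP S0|_]; first by rewrite S0 in Sx.
by have [+ _] := xgetPex +oo%E (infimums_neq0 S); apply.
Qed.

End BarIntBounds.

Section Grade.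
Variable R : comNzRingType.

(** Were all regular sequences in I of length at most 1, so would be the supremum; x, y are the
    first two terms of a longer one. The case [I 1] is that of grade +oo by convention. *)
Lemma grade_ge2 (I : set R) : (2%:Z%:E <= grade_ideal I)%E ->
  I 1 \/ exists x y, [/\ I x, I y, forall z, x * z = 0 -> z = 0 &
    forall z a, y * z = a * x -> exists b, z = b * x].
Proof.
rewrite /grade_ideal; case: asboolP => [I1 _|_ gr]; first by left.
right; apply: contrapT => H; move: gr; apply/negP; rewrite -ltNge.
apply: (@le_lt_trans _ _ 1%:Z%:E%E) => //; apply: supremum_le => _ [s [[_ reg] sI] <-].
rewrite lee_fin lez_nat leqNgt; apply/negP => s2; apply: H.
case: s s2 reg sI => [|x [|y s]] // _ reg sI.
exists x, y; split.
- by apply: sI; rewrite /= mem_head.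
- by apply: sI; rewrite /= !inE eqxx orbT.
- move=> z xz; have := reg 0%N isT z; rewrite /= xz => /(_ (ideal_zero (ideal_ideal_gen _))).
  have id0 : ideal [set 0 : R].
    by apply: ideal_intro => [//|_ _ -> ->|a _ ->] /=; rewrite ?addr0 ?mulr0.
  by apply: (ideal_gen_sub id0) => w /=; rewrite in_nil.
- move=> z a yz; have := reg 1%N isT z; rewrite /= yz.
  have H1 : ideal_gen [set` [:: x]] (a * x).
    apply: (ideal_mull a (ideal_ideal_gen _)).
    by apply: sub_ideal_gen; rewrite /= mem_head.
  move=> /(_ H1); apply: (ideal_gen_sub (ideal_princ x)) => w /=.
  by rewrite inE => /eqP ->; apply: princ_id.
Qed.

End Grade.

Section ExteriorDeterminant.
Variables (R : comNzRingType) (e : nat) (E : lmodType R) (kappa : {linear E -> 'rV[R]_e}).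

(** The determinant is multilinear and alternating, so it descends to the exterior power. *)
Lemma exterior_det : exists D : {linear exterior_power e E -> R^o},
  (forall u : 'I_e -> E, range D (\det (\matrix_i kappa (u i)))) /\
  forall J : set R, ideal J -> (forall u : 'I_e -> E, J (\det (\matrix_i kappa (u i)))) ->
    range D `<=` J.
Proof.
pose h (u : {ffun 'I_e -> E}) : R^o := \det (\matrix_i kappa (u i)).
have hX g : @ext_rel R e E g -> malglift h g = 0.
  case=> [[i [a [u [v [w [uvw wi ->]]]]]]|[i [j [u [ij uij ->]]]]].
    rewrite raddfB /= malglift_linear !malglift_mgen; apply/eqP; rewrite subr_eq0; apply/eqP.
    rewrite -[h v]mul1r; apply: (determinant_multilinear (i0 := i)).
    + by apply/rowP => k; rewrite !mxE wi linearP !mxE mul1r.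
    + apply/matrixP => k l; rewrite !mxE; have [|-> _ //] := uvw (lift i k).
      by rewrite eq_sym neq_lift.
    + apply/matrixP => k l; rewrite !mxE; have [|_ -> //] := uvw (lift i k).
      by rewrite eq_sym neq_lift.
  rewrite malglift_mgen; apply: (determinant_alternate ij) => k.
  by rewrite !mxE uij.
pose D0 : exterior_power e E -> R^o := quotlift (X := @ext_rel R e E) (malglift h).
have D0E g : D0 (qpi (@ext_rel R e E) g) = malglift h g := quotlift_qpi hX g.
have D0lin : linear D0 := quotlift_linear hX.
pose Dmix := GRing.isLinear.Build R _ _ _ D0 D0lin.
exists (HB.pack_for {linear exterior_power e E -> R^o} D0 Dmix); split=> [u|J idJ Ju].
  exists (qpi (@ext_rel R e E) (mgen R [ffun i => u i])) => //.
  rewrite /= D0E malglift_mgen; congr (\det _); apply/matrixP => i j.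
  by rewrite !mxE ffunE.
move=> _ [w _ <-] /=; elim/qpi_ind: w => g; rewrite D0E.
elim/malg_ind: g => [|a u g IHg].
  by rewrite (raddf0 (malglift h)); apply: ideal_zero.
rewrite malglift_linear malglift_mgen; apply: ideal_add => //.
exact: (ideal_mull a idJ (Ju u)).
Qed.

End ExteriorDeterminant.

Section Minors.
Variables (R : comNzRingType) (M : lmodType R).

(* Eliminating the generators in the columns of the minor leaves at most k. *)
Lemma presents_minor (n p k : nat) (phi : 'M[R]_(p, n)) (r : 'I_(n - k) -> 'I_p)
    (c : 'I_(n - k) -> 'I_n) :
  presents phi M -> injective c ->
  exists u : 'I_k -> M, forall x, exists a : 'I_k -> R,
    \det (mxsub r c phi) *: x = \sum_i a i *: u i.
Proof.
move=> [f [fsurj fker]] cinj; set B := mxsub r c phi; set d := \det B.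
pose x j : M := f (delta_mx 0 j).
have fE v : f v = \sum_j v 0 j *: x j.
  by rewrite {1}[v]row_sum_delta linear_sum; apply: eq_bigr => j _; rewrite linearZ.
have rel i : \sum_j phi i j *: x j = 0.
  have /fker : exists w : 'rV_p, row i phi = w *m phi.
    by exists (delta_mx 0 i); rewrite rowE.
  by rewrite fE => {2}<-; apply: eq_bigr => j _; rewrite mxE.
pose s := [seq x j | j <- enum [pred j | j \notin codom c]].
have ss : (size s <= k)%N.
  rewrite size_map -cardE.
  have := cardC (mem (codom c)); rewrite card_ord card_codom // card_ord => E.
  by rewrite -(leq_add2l (n - k)) E addnC -leq_subLR.
(* When s has fewer than k entries, the default of [nth] pads the family with zeros. *)
pose u (i : 'I_k) := s`_i; exists u.
pose W := [set z | exists a : 'I_k -> R, z = \sum_i a i *: u i].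
have W0 : W 0 by exists (fun=> 0); rewrite big1 // => i _; rewrite scale0r.
have WP a y z : W y -> W z -> W (a *: y + z).
  move=> [b ->] [b' ->]; exists (fun i => a * b i + b' i).
  by rewrite scaler_sumr -big_split; apply: eq_bigr => i _; rewrite scalerDl scalerA.
have Wsum (T : Type) (l : seq T) (P : pred T) (F : T -> M) (b : T -> R) :
    (forall i, P i -> W (F i)) -> W (\sum_(i <- l | P i) b i *: F i).
  move=> WF; elim: l => [|i l IHl]; first by rewrite big_nil.
  by rewrite big_cons; case: ifP => // Pi; apply: WP => //; apply: WF.
have Wu i : W (u i).
  exists (fun j => (j == i)%:R); rewrite (bigD1 i) //= eqxx scale1r big1 ?addr0 //.
  by move=> j /negPf ->; rewrite scale0r.
have Wx j : j \notin codom c -> W (x j).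
  move=> jc; have xs : x j \in s by apply: map_f; rewrite mem_enum.
  have ik : (index (x j) s < k)%N by apply: leq_trans ss; rewrite index_mem.
  by have := Wu (Ordinal ik); rewrite /u /= nth_index.
have Wcol i : W (\sum_l B i l *: x (c l)).
  have := rel (r i); rewrite (bigID (mem (codom c))) /= => /eqP.
  rewrite addr_eq0 => /eqP E.
  have -> : \sum_l B i l *: x (c l) = - \sum_(j | j \notin codom c) phi (r i) j *: x j.
    rewrite -E -big_uniq; last by rewrite map_inj_uniq ?enum_uniq.
    rewrite big_image /=.
    by apply: eq_bigr => l _; rewrite mxE.
  by rewrite -scaleN1r -[_ *: _]addr0; apply: WP => //; apply: Wsum.
have Wdx j : W (d *: x j).
  have [/codomP [l ->]|jc] := boolP (j \in codom c); last first.
    by rewrite -[_ *: _]addr0; apply: WP => //; apply: Wx.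
  (* Cramer's rule: by [Wcol] the inner sums already lie in W. *)
  have -> : d *: x (c l) = \sum_i \adj B l i *: (\sum_l' B i l' *: x (c l')).
    under eq_bigr do rewrite scaler_sumr.
    rewrite exchange_big /= (bigD1 l) //= [X in _ + X]big1 => [|l' ll'].
      rewrite addr0.
      under eq_bigr do rewrite scalerA.
      rewrite -scaler_suml; congr (_ *: _).
      by have /matrixP /(_ l l) := mul_adj_mx B; rewrite [LHS]mxE [RHS]mxE eqxx mulr1n => ->.
    under eq_bigr do rewrite scalerA.
    rewrite -scaler_suml.
    have /matrixP /(_ l l') := mul_adj_mx B.
    rewrite [LHS]mxE [RHS]mxE eq_sym (negPf ll') mulr0n => ->.
    by rewrite scale0r.
  exact: Wsum.
move=> y; have [v <-] := fsurj y; rewrite fE scaler_sumr.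
have : W (\sum_j v 0 j *: (d *: x j)) by apply: Wsum.
by under eq_bigr do rewrite scalerA mulrC -scalerA.
Qed.

End Minors.

Lemma bar_int_unbounded (t : \bar int) : (forall n : nat, (n%:Z%:E <= t)%E) -> t = +oo%E.
Proof.
case: t => [k|//|] H; last by have := H 0%N; rewrite leeNy_eq.
have := H (absz k).+1; rewrite lee_fin => kk; have := le_trans kk (ler_norm k).
by rewrite -abszE lez_nat ltnn.
Qed.

(** * Analytic spread and heights of primes over I *)

Section Spread.
Variables (R : comNzRingType) (m : set R).
Hypotheses (R_noeth : noetherian R) (R_local : local_ring m).
Variables (M : lmodType R) (D : {linear M -> R^o}).

Lemma analytic_spread_ge n c : graded_chain m (range D) n c ->
  (n%:Z%:E <= analytic_spread m M)%E.
Proof.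
move=> /rees_prime_chain [c' cc' mc'].
have [c'' cc''] := tensalg_prime_chain cc' mc'.
by apply: le_supremum; exists n => //; exists c''.
Qed.

(** Let h be the least length without a chain of homogeneous primes. Then the spread is at least h -
    1, while some prime over I has only chains shorter than h. If chains of all lengths exist, the
    spread is +oo and m serves. *)
Lemma height_prime_le_spread : range D `<=` m ->
  exists P, [/\ prime_ideal P, range D `<=` P & (height_prime P <= analytic_spread m M)%E].
Proof.
move=> Im; have idI := ideal_range D; have pm := local_prime R_noeth R_local.
have [allch|/existsNP nch] :=
  pselect (forall n, exists c, graded_chain m (range D) n c).
  exists m; split=> //; rewrite (@bar_int_unbounded (analytic_spread m M)) ?leey // => n.
  by have [c /analytic_spread_ge] := allch n.
have ex : exists n, `[< ~ exists c, graded_chain m (range D) n c >].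
  by have [n Hn] := nch; exists n; apply/asboolP.
have [h /asboolP nh hmin] := find_ex_minn ex.
have [P /not_implyP [pP /not_implyP [IP Pht]]] : exists P, ~ (prime_ideal P -> range D `<=` P ->
     exists n c, [/\ (h <= n)%N, prime_chain n c & c n = P]).
  by apply/existsNP => H; apply: nh; apply: graded_chain_exists.
have ltP n c : prime_chain n c -> c n = P -> (n < h)%N.
  by move=> cc cP; rewrite ltnNge; apply/negP => hn; apply: Pht; exists n, c.
have h0 : (0 < h)%N by apply: (ltP 0%N (fun=> P)) => //; split.
exists P; split=> //; apply: supremum_le => _ [n [c [cc cP]] <-].
have [c'] : exists c', graded_chain m (range D) h.-1 c'.
  apply: contrapT => H; have := hmin h.-1 (asboolT H).
  by rewrite leqNgt prednK // leqnn.
move=> /analytic_spread_ge; apply: le_trans; rewrite lee_fin lez_nat.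
by rewrite -ltnS prednK //; apply: (ltP n c).
Qed.

End Spread.

Lemma height_le (A : comPzRingType) (I P : set A) : prime_ideal P -> I `<=` P ->
  (height I <= height_prime P)%E.
Proof. by move=> pP IP; apply: infimum_le; exists P. Qed.

(** * Fitting ideals of G/E and E inside a prime over I *)

Section EmbeddedModule.
Variables (R : comNzRingType) (e : nat) (E G : lmodType R) (iota : {linear E -> G}).
Variable gamma : {linear G -> 'rV[R]_e}.
Hypothesis gamma_bij : bijective gamma.

Local Notation umx u := (\matrix_i gamma (iota (u i))).

Lemma annihilator_quot_by a g : annihilator (quot_by iota) a ->
  exists x, iota x = a *: g.
Proof.
move=> aGE; have /qpiP : qpi (range iota) (a *: g) = qpi (range iota) 0.
  by rewrite linearZ raddf0; apply: aGE.
rewrite subr0; have smi : submodule (range iota).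
  split; first by exists 0; rewrite ?raddf0.
  by move=> b _ _ [x _ <-] [y _ <-]; exists (b *: x + y); rewrite ?linearP.
by move=> /(lspan_sub smi (@subset_refl _ _)) [x _ <-]; exists x.
Qed.

Lemma annihilator_scalar a : annihilator (quot_by iota) a ->
  exists y : 'I_e -> E, umx y = a%:M.
Proof.
move=> aGE; have [gamma' gammaK gamma'K] := gamma_bij.
have /choice [y yE] (i : 'I_e) : exists x, iota x = a *: gamma' (delta_mx 0 i).
  exact: annihilator_quot_by.
exists y; apply/matrixP => i j; rewrite !mxE yE linearZ gamma'K !mxE eqxx /=.
by rewrite eq_sym mulr_natr.
Qed.

Lemma annihilator_factor (u : 'I_e -> E) d a :
  (forall x, exists b : 'I_e -> R, d *: x = \sum_i b i *: u i) ->
  annihilator (quot_by iota) a -> exists C : 'M[R]_e, (d * a)%:M = C *m umx u.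
Proof.
move=> uE /annihilator_scalar [y yE]; have /choice [b bE] i := uE (y i).
exists (\matrix_(i, j) b i j); rewrite -scale_scalar_mx -yE; apply/matrixP => i j.
transitivity (gamma (iota (d *: y i)) 0 j); first by rewrite !linearZ !mxE.
rewrite bE !linear_sum summxE mxE; apply: eq_bigr => k _.
by rewrite !linearZ !mxE.
Qed.

Lemma fitting_sub (P I : set R) (M : lmodType R) i : prime_ideal P ->
  (forall n p (phi : 'M[R]_(p, n)) r c, presents phi M -> injective c ->
    P (\det (mxsub r c phi : 'M_(n - i)))) ->
  fitting_ideal i M `<=` P.
Proof.
move=> pP H a [n [p [phi [phiM]]]]; apply: ideal_gen_sub; first exact: prime_ideal_ideal.
by move=> _ [r [c [_ cinj ->]]]; apply: H.
Qed.

Variable P : set R.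
Hypotheses (pP : prime_ideal P) (detP : forall u : 'I_e -> E, P (\det (umx u))).

Lemma fitting_quot_sub : fitting_ideal 0 (quot_by iota) `<=` P.
Proof.
apply: fitting_sub => // n p phi r c phiM cinj; set d := \det _.
have [u uE] := @presents_minor _ _ n p 0 phi r c phiM cinj.
have /annihilator_scalar [y yE] : annihilator (quot_by iota) d.
  by move=> x; have [b ->] := uE x; rewrite big_ord0.
have := detP y; rewrite yE det_scalar; exact: primeX.
Qed.

(* Away from P, the rows of U span E. For x and y annihilating G/E, d x = C U and
   d y = C' U give y C = x C' up to a power of d, so x divides C if x, y is a
   regular sequence; cancelling x makes U invertible away from P. *)
Lemma fitting_ideal_module_sub : (2%:Z%:E <= grade (quot_by iota))%E ->
  fitting_ideal e E `<=` P.
Proof.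
move=> gr; apply: fitting_sub => // n p phi r c phiM cinj; set d := \det _.
apply: contrapT => Pd; have idP := prime_ideal_ideal pP.
have [u uE] := @presents_minor _ _ n p e phi r c phiM cinj.
pose U := umx u; pose delta := \det U.
have Pdelta : P delta by apply: detP.
have notP a C : a%:M = C *m U -> P a.
  move=> /(congr1 determinant); rewrite det_scalar det_mulmx => aE.
  by apply: (primeX (n := e) pP); rewrite aE; apply: ideal_mull.
have [a1|[x [y [ax ay xreg xyreg]]]] := grade_ge2 gr.
  by have [C /notP] := annihilator_factor uE a1; rewrite mulr1.
have [C CE] := annihilator_factor uE ax; have [C' CE'] := annihilator_factor uE ay.
have adjE (a : R) (B : 'M[R]_e) i j : a%:M = B *m U -> a * \adj U i j = delta * B i j.
  move=> BE; have : a%:M *m \adj U = delta *: B.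
    by rewrite BE -mulmxA mul_mx_adj mul_mx_scalar.
  by rewrite mul_scalar_mx => /matrixP /(_ i j); rewrite [LHS]mxE [RHS]mxE.
have detC : (d * x) ^+ e = \det C * delta.
  by have /(congr1 determinant) := CE; rewrite det_scalar det_mulmx.
have xregX k z : x ^+ k * z = 0 -> z = 0.
  by elim: k => [|k IHk]; [rewrite mul1r|rewrite exprS -mulrA => /xreg].
(* After multiplication by x^e the factor (d x)^e = det C * delta appears, and delta turns both
   entries into the same multiple of [\adj U i j]. *)
have key i j : d ^+ e * (y * C i j - x * C' i j) = 0.
  apply: (xregX e); rewrite mulrA -exprMn [x * d]mulrC detC -mulrA mulrBr.
  rewrite [delta * (y * _)]mulrCA [delta * (x * _)]mulrCA.
  rewrite -(adjE _ _ i j CE) -(adjE _ _ i j CE') !mulrA.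
  by rewrite [y * d]mulrC [x * d]mulrC [d * y * x]mulrAC subrr mulr0.
have /choice [b bE] (ij : 'I_e * 'I_e) : exists b, d ^+ e * C ij.1 ij.2 = b * x.
  apply: (xyreg _ (d ^+ e * C' ij.1 ij.2)).
  apply/eqP; rewrite -subr_eq0 mulrCA [_ * x]mulrC [x * _]mulrCA -mulrBr.
  by rewrite key.
(* This is d^e (d x) = d^e C U with the non-zero-divisor x cancelled; [notP] then puts a power of d
   in P. *)
have : (d ^+ e * d)%:M = (\matrix_(i, j) b (i, j)) *m U.
  apply/matrixP => i j; apply/eqP; rewrite -subr_eq0; apply/eqP/xreg.
  rewrite mulrBr; apply/eqP; rewrite subr_eq0; apply/eqP.
  transitivity (d ^+ e * (d * x)%:M i j).
    by rewrite !mxE !mulrnAr [x * _]mulrC mulrA.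
  rewrite CE [X in d ^+ e * X]mxE [X in x * X]mxE !mulr_sumr; apply: eq_bigr => k _.
  by rewrite [LHS]mulrA [d ^+ e * _](bE (i, k)) [(\matrix_(_, _) _) i k]mxE mulrA [x * _]mulrC.
by move=> /notP /(primeM pP) [/(primeX pP)|].
Qed.

End EmbeddedModule.

(** The rows [kappa (u i)] form an invertible matrix, so the injective [kappa] is also onto. *)
Lemma free_of_unit_det (R : comNzRingType) (e : nat) (E : lmodType R)
    (kappa : {linear E -> 'rV[R]_e}) (u : 'I_e -> E) b :
  injective kappa -> b * \det (\matrix_i kappa (u i)) = 1 -> free_module E.
Proof.
move=> kinj bdet; set U := \matrix_i kappa (u i) in bdet.
pose B := b *: \adj U; have BU : B *m U = 1%:M.
  by rewrite -scalemxAl mul_adj_mx scale_scalar_mx bdet.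
exists e, kappa; pose k' (v : 'rV_e) := \sum_i (v *m B) 0 i *: u i.
have k'K v : kappa (k' v) = v.
  rewrite linear_sum -[RHS]mulmx1 -BU mulmxA [RHS]mulmx_sum_row.
  by apply: eq_bigr => i _; rewrite linearZ rowK.
by exists k' => // x; apply: kinj; rewrite k'K.
Qed.

Theorem proposition2p3 (R : comNzRingType) (m : set R)
    (R_noeth : noetherian R) (R_local : local_ring m)
    (e : nat) (E G : lmodType R) (iota : {linear E -> G})
    (G_free : lin_iso G 'rV[R]_e) (iota_inj : injective iota)
    (E_fg : finitely_generated E) (E_tf : torsionfree E)
    (E_rank : has_rank E e) (e_gt0 : (0 < e)%N) (E_nfree : ~ free_module E) :
  (height (fitting_ideal 0 (quot_by iota))
     <= analytic_spread m (exterior_power e E))%E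
  /\ (ideal_module iota ->
      (height (fitting_ideal e E)
         <= analytic_spread m (exterior_power e E))%E).
Proof.
have [gamma gamma_bij] := G_free.
have [D [Ddet Dsub]] := exterior_det (gamma \o iota : {linear E -> 'rV[R]_e}).
(* A determinant outside m is a unit and would make E free. *)
have Im : range D `<=` m.
  apply: Dsub => [|u]; first exact: local_ideal.
  apply: contrapT => /(local_unit R_noeth R_local) [b bdet]; apply: E_nfree.
  by apply: free_of_unit_det bdet; apply: inj_comp => //; apply: bij_inj.
have [P [pP IP htP]] := height_prime_le_spread R_noeth R_local Im.
have detP u : P (\det (\matrix_i gamma (iota (u i)))) by apply: IP; apply: Ddet.
split=> [|[_ _ _ gr]]; apply: le_trans htP; apply: height_le => //.
  exact (fitting_quot_sub gamma_bij pP detP).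
exact (fitting_ideal_module_sub gamma_bij pP detP gr).
Qed.
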